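(* Let $m_1,n\ge1$ be integers and $m=2m_1+1$. For every $r\in\overline{0,m_1}$ and every integer $k$ (with $k\ge0$ if $r=0$), the $osp(2m_1+1,2n)$-module $\mathcal H^r_k$ is irreducible; and for every subset $T\subset\overline{1,2n}$ and every $k\in\mathbb N$, the $osp(2m_1+1,2n)$-module $\mathcal A'_k$ (defined with respect to $T$) is irreducible.
   Context: $\mathbb N$ is the set of nonnegative integers, $\overline{i,j}=\{i,i+1,\dots,j\}$. $E_{i,j}$ is the square matrix with $(i,j)$-entry $1$ and others zero. The Lie superalgebra $gl(m,2n)$ of $(m+2n)\times(m+2n)$ complex matrices has even part spanned by $E_{i,j}$ ($i,j\in\overline{1,m}$) and $E_{m+s,m+t}$ ($s,t\in\overline{1,2n}$), odd part spanned by $E_{i,m+s},E_{m+s,i}$, and bracket $[u,v]=uv-(-1)^{\iota_1\iota_2}vu$ for $u,v$ of parities $\iota_1,\iota_2$. For $m=2m_1+1$, $osp(m,2n)$ is the subalgebra of matrices $$\begin{pmatrix}A&B&U&H&H_1\\ C&-A^T&V&K&K_1\\ -V^T&-U^T&0&M&M_1\\ K_1^T&H_1^T&M_1^T&D&E\\ -K^T&-H^T&-M^T&F&-D^T\end{pmatrix}$$ with $A,B,C$ of size $m_1\times m_1$, $B=-B^T$, $C=-C^T$; $D,E,F$ of size $n\times n$, $E=E^T$, $F=F^T$; $H,H_1,K,K_1$ of size $m_1\times n$; $U,V$ of size $m_1\times1$; $M,M_1$ of size $1\times n$. In the polynomial algebras below the $x_i$ commute with everything, the $\theta_p$ anticommute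 among themselves, and $\partial_{\theta_p}$ is the odd (left) derivation with $\partial_{\theta_p}(\theta_q)=\delta_{p,q}$. ''Irreducible'' means having no submodules other than $0$ and itself (the degenerate case $T=\overline{1,2n}$, $k>m$, where $\mathcal A'_k=0$, is not excluded). (First family.) On $\mathcal A=\mathbb C[x_1,\dots,x_m,\theta_1,\dots,\theta_{2n}]$, for fixed $r\in\overline{0,m_1}$, $gl(m,2n)$ and by restriction $osp(m,2n)$ act by: - $E_{i,j}\mapsto -x_j\partial_{x_i}-\delta_{i,j}$ if $i,j\in\overline{1,r}$; $\partial_{x_i}\partial_{x_j}$ if $i\in\overline{1,r}$, $j\in\overline{r+1,m}$; $-x_ix_j$ if $j\in\overline{1,r}$, $i\in\overline{r+1,m}$; $x_i\partial_{x_j}$ if $i,j\in\overline{r+1,m}$; - for $p\in\overline{1,2n}$: $E_{i,m+p}\mapsto\partial_{x_i}\partial_{\theta_p}$ if $i\in\overline{1,r}$, and $x_i\partial_{\theta_p}$ if $i\in\overline{r+1,m}$; - for $p\in\overline{1,2n}$: $E_{m+p,j}\mapsto-\theta_px_j$ if $j\in\overline{1,r}$, and $\theta_p\partial_{x_j}$ if $j\in\overline{r+1,m}$; - $E_{m+p,m+q}\mapsto\theta_p\partial_{\theta_q}$ for $p,q\in\overline{1,2n}$. For $k\in\mathbb Z$, $\mathcal A^r_k$ is the span of all $x^\alpha\theta_{i_1}\cdots\theta_{i_t}$ with $0\le t\le2n$, $i_1,\dots,i_t\in\overline{1,2n}$, $\alpha\in\mathbb N^m$, $t-\sum_{i=1}^r\alpha_i+\sum_{j=r+1}^m\alpha_j=k$.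 Put $$\Delta=-2\sum_{i=1}^rx_i\partial_{x_{m_1+i}}+2\sum_{i=r+1}^{m_1}\partial_{x_i}\partial_{x_{m_1+i}}+\partial_{x_{2m_1+1}}^2+2\sum_{j=1}^n\partial_{\theta_j}\partial_{\theta_{n+j}},$$ and $\mathcal H^r_k=\{f\in\mathcal A^r_k\mid\Delta(f)=0\}$, an $osp(m,2n)$-submodule. (Second family.) On $\mathcal A'=\mathbb C[x_1,\dots,x_{2n};\theta_1,\dots,\theta_m]$, for fixed $T\subset\overline{1,2n}$ and $\bar T=\overline{1,2n}\setminus T$, $osp(m,2n)$ acts via: - $E_{p,q}\mapsto\theta_p\partial_{\theta_q}$ for $p,q\in\overline{1,m}$; - $E_{m+i,m+j}\mapsto -x_j\partial_{x_i}-\delta_{i,j}$ if $i,j\in T$; $\partial_{x_i}\partial_{x_j}$ if $i\in T,j\in\bar T$; $-x_ix_j$ if $i\in\bar T,j\in T$; $x_i\partial_{x_j}$ if $i,j\in\bar T$; - for $p\in\overline{1,m}$: $E_{m+i,p}\mapsto\partial_{x_i}\partial_{\theta_p}$ if $i\in T$, and $x_i\partial_{\theta_p}$ if $i\in\bar T$; - for $p\in\overline{1,m}$: $E_{p,m+j}\mapsto-\theta_px_j$ if $j\in T$, and $\theta_p\partial_{x_j}$ if $j\in\bar T$. For $k\in\mathbb N$, $\mathcal A'_k$ is the span of all $x^\alpha\theta_{i_1}\cdots\theta_{i_t}$ with $t\in\overline{0,m}$, $i_1,\dots,i_t\in\overline{1,m}$, $\alpha\in\mathbb N^{2n}$ and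 $\sum_{i\in\bar T}\alpha_i-\sum_{i\in T}\alpha_i=k-t$; it is an $osp(m,2n)$-submodule. *)

(* Defs.v *)
From mathcomp Require Import all_boot all_order all_algebra.
From mathcomp.multinomials Require Import mpoly.

Set Implicit Arguments.
Unset Strict Implicit.
Unset Printing Implicit Defensive.

Import GRing.Theory.

Local Open Scope ring_scope.

(* F[x_1, .., x_M] (x) Lambda(theta_1, .., theta_N): the element f stands for
   \sum_S f(S) * theta_S, where theta_S is the product of the theta_p, p \in S,
   taken in increasing order of p. *)
Notation superpoly F M N := {ffun {set 'I_N} -> {mpoly F[M]}}.

Section SuperPolynomials.
Variables (F : fieldType) (M N : nat).
Local Notation A := (superpoly F M N).
Implicit Types (f : A) (p q : 'I_N) (S : {set 'I_N}).

Definition spconst (c : {mpoly F[M]}) : A :=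
  [ffun S : {set 'I_N} => if S == set0 then c else 0].

Definition xmul (i : 'I_M) f : A := [ffun S : {set 'I_N} => 'X_i * f S].
Definition dx (i : 'I_M) f : A := [ffun S : {set 'I_N} => mderiv i (f S)].

(* The sign of moving theta_p to its place among the factors of theta_S. *)
Definition thsign p S : F := (-1) ^+ #|[set q in S | (q < p)%N]|.

(* Left multiplication by theta_p, and the odd left derivation by theta_p. *)
Definition thmul p f : A :=
  [ffun S : {set 'I_N} => if p \in S then thsign p S *: f (S :\ p) else 0].
Definition dth p f : A :=
  [ffun S : {set 'I_N} => if p \in S then 0 else thsign p S *: f (p |: S)].

(* x^alpha * theta_(i_1) * .. * theta_(i_t) for s = [:: i_1; ..; i_t]. *)
Definition spmonomial (alpha : 'X_{1..M}) (s : seq 'I_N) : A :=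
  foldr thmul (spconst 'X_[alpha]) s.

Definition in_span (V : lmodType F) (B : V -> Prop) (v : V) : Prop :=
  exists k (c : 'I_k -> F) (b : 'I_k -> V),
    (forall i, B (b i)) /\ v = \sum_i c i *: b i.

(* Span of the monomials whose degree is k, where the degree of x_i is -1 for
   i \in T and 1 for i \notin T, and the degree of every theta_p is 1. *)
Definition component (T : {set 'I_M}) (k : int) : A -> Prop :=
  in_span (fun g => exists (alpha : 'X_{1..M}) (s : seq 'I_N),
    [/\ (size s <= N)%N,
        (size s)%:Z - \sum_(i in T) (alpha i)%:Z
          + \sum_(i in ~: T) (alpha i)%:Z = k
      & g = spmonomial alpha s]).

(* The operators of the oscillator representation twisted at the variables
   x_i, i \in T. They represent E_(i,j) with i and j both bosonic (osc_bb), with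
   i bosonic and p fermionic (osc_bf), with p fermionic and j bosonic (osc_fb),
   with p and q both fermionic (osc_ff). *)
Definition osc_bb (T : {set 'I_M}) (i j : 'I_M) f : A :=
  match i \in T, j \in T with
  | true, true => - xmul j (dx i f) - (i == j)%:R *: f
  | true, false => dx i (dx j f)
  | false, true => - xmul i (xmul j f)
  | false, false => xmul i (dx j f)
  end.

Definition osc_bf (T : {set 'I_M}) (i : 'I_M) (p : 'I_N) f : A :=
  if i \in T then dx i (dth p f) else xmul i (dth p f).

Definition osc_fb (T : {set 'I_M}) (p : 'I_N) (j : 'I_M) f : A :=
  if j \in T then - thmul p (xmul j f) else thmul p (dx j f).

Definition osc_ff (p q : 'I_N) f : A := thmul p (dth q f).

Lemma thsignD1 p q S : q != p ->
  thsign p (S :\ q) = (if (q \in S) && (q < p)%N then -1 else 1) * thsign p S.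
Proof.
move=> nqp; rewrite /thsign.
have -> : [set t in S :\ q | (t < p)%N] = [set t in S | (t < p)%N] :\ q.
  by apply/setP=> t; rewrite !inE -andbA.
rewrite (cardsD1 q [set t in S | (t < p)%N]) inE.
by case: ifP => _; rewrite ?add0n ?mul1r // add1n exprS mulrA mulrNN mulr1 mul1r.
Qed.

Lemma thmulC p q f : thmul p (thmul q f) = - thmul q (thmul p f).
Proof.
apply/ffunP=> S; rewrite !ffunE.
have [->|npq] := eqVneq p q.
  by rewrite !inE eqxx /= scaler0; case: ifP; rewrite oppr0.
rewrite !inE (eq_sym q p) npq /=.
case pS: (p \in S); case qS: (q \in S); rewrite ?scaler0 ?oppr0 //.
rewrite !scalerA -scaleNr !thsignD1 ?(eq_sym q p) // pS qS /=.
have -> : S :\ q :\ p = S :\ p :\ q.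
  by apply/setP=> t; rewrite !inE andbCA.
congr (_ *: _).
by case: (ltngtP p q) npq => [||/val_inj->]; rewrite ?eqxx //= => _ _;
   rewrite !mul1r ?mulN1r ?mulrN ?opprK mulrC.
Qed.

Lemma dth_thmul p q f : dth p (thmul q f) = (p == q)%:R *: f - thmul q (dth p f).
Proof.
have sgn2 t S' : thsign t S' * thsign t S' = 1 by rewrite /thsign -expr2 sqrr_sign.
have signD t S' : thsign t (S' :\ t) = thsign t S'.
  rewrite /thsign; congr (_ ^+ _); apply: eq_card => u; rewrite !inE.
  by case: eqVneq => // ->; rewrite ltnn !andbF.
have signU t S' : thsign t (t |: S') = thsign t S'.
  rewrite /thsign; congr (_ ^+ _); apply: eq_card => u; rewrite !inE.
  by case: eqVneq => // ->; rewrite ltnn !andbF.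
apply/ffunP=> S; rewrite !ffunE.
have [<-|npq] := eqVneq p q.
  rewrite scale1r !inE eqxx /=; case: ifP => pS.
    by rewrite setD1K // signD scalerA sgn2 scale1r subrr.
  by rewrite setU1K ?pS // signU scalerA sgn2 scale1r subr0.
rewrite scale0r !inE npq (eq_sym q p) (negPf npq) /= sub0r.
case pS: (p \in S); case qS: (q \in S); rewrite ?scaler0 ?oppr0 //.
have -> : (p |: S) :\ q = p |: S :\ q.
  by apply/setP=> t; rewrite !inE; case: (eqVneq t p) => // ->; rewrite npq.
rewrite !scalerA -scaleNr; congr (_ *: _).
have -> : thsign q S = (if (p < q)%N then -1 else 1) * thsign q (p |: S).
  by rewrite -{1}[S](setU1K (negbT pS)) thsignD1 // !inE eqxx.
rewrite thsignD1 ?(eq_sym q p) // qS /=.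
by case: (ltngtP p q) npq => [||/val_inj->]; rewrite ?eqxx //= => _ _;
   rewrite !mul1r ?mulN1r ?mulNr ?mulrN ?opprK mulrC.
Qed.

Lemma dth_const p c : dth p (spconst c) = 0.
Proof.
apply/ffunP=> S; rewrite !ffunE; case: ifP => // _.
have /negPf-> : p |: S != set0 by apply/set0Pn; exists p; rewrite !inE eqxx.
by rewrite scaler0.
Qed.

End SuperPolynomials.

Section LinearExtension.
Variables (F : fieldType) (d : nat) (V : lmodType F).

Definition mx_act (E : 'I_d -> 'I_d -> V -> V) (X : 'M[F]_d) (v : V) : V :=
  \sum_i \sum_j X i j *: E i j v.

(* Submodules are not required to be graded by parity. *)
Definition is_submodule (L : 'M[F]_d -> Prop) (act : 'M[F]_d -> V -> V)
    (W : V -> Prop) : Prop :=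
  [/\ W 0,
      forall u v, W u -> W v -> W (u + v),
      forall a v, W v -> W (a *: v)
    & forall X v, L X -> W v -> W (act X v)].

Definition irreducible (L : 'M[F]_d -> Prop) (act : 'M[F]_d -> V -> V)
    (U : V -> Prop) : Prop :=
  is_submodule L act U /\
  forall W, is_submodule L act W -> (forall v, W v -> U v) ->
    (forall v, W v -> v = 0) \/ (forall v, U v -> W v).

End LinearExtension.

Section Osp.
Variables (F : fieldType) (m1 n : nat).

(* The lower right block is [D, E; G, -D^T]; the letter F denotes the field. *)
Definition osp (X : 'M[F]_((m1 + m1 + 1) + (n + n))) : Prop :=
  exists (A B C : 'M[F]_m1) (D E G : 'M[F]_n) (H H1 K K1 : 'M[F]_(m1, n))
    (U V : 'cV[F]_m1) (M M1 : 'rV[F]_n),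
    [/\ B = - B^T, C = - C^T, E = E^T, G = G^T
      & X = block_mx
          (block_mx (block_mx A B C (- A^T)) (col_mx U V)
                    (row_mx (- V^T) (- U^T)) 0)
          (col_mx (block_mx H H1 K K1) (row_mx M M1))
          (row_mx (block_mx K1^T H1^T (- K^T) (- H^T)) (col_mx M1^T (- M^T)))
          (block_mx D E G (- D^T))].

(* First family, on F[x_1, .., x_m, theta_1, .., theta_2n]: the
   m = 2 * m1 + 1 even indices of gl(m, 2n) are bosonic and the 2n odd ones are
   fermionic. *)
Local Notation A1 := (superpoly F (m1 + m1 + 1) (n + n)).

Definition lowset (r : nat) : {set 'I_(m1 + m1 + 1)} :=
  [set i : 'I_(m1 + m1 + 1) | (i < r)%N].

Definition glE1 (r : nat) (a b : 'I_((m1 + m1 + 1) + (n + n))) : A1 -> A1 :=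
  match split a, split b with
  | inl i, inl j => osc_bb (lowset r) i j
  | inl i, inr p => osc_bf (lowset r) i p
  | inr p, inl j => osc_fb (lowset r) p j
  | inr p, inr q => osc_ff p q
  end.

Definition osp_act1 (r : nat) (X : 'M[F]_((m1 + m1 + 1) + (n + n))) (f : A1) :
  A1 := mx_act (glE1 r) X f.

(* The variables x_i, x_(m1+i), 1 <= i <= m1, and x_(2*m1+1). *)
Definition xa (i : 'I_m1) : 'I_(m1 + m1 + 1) := lshift 1 (lshift m1 i).
Definition xb (i : 'I_m1) : 'I_(m1 + m1 + 1) := lshift 1 (rshift m1 i).
Definition xc : 'I_(m1 + m1 + 1) := rshift (m1 + m1) ord0.

Definition Delta (r : nat) (f : A1) : A1 :=
  - (2%:R *: \sum_(i < m1 | (i < r)%N) xmul (xa i) (dx (xb i) f))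
  + 2%:R *: (\sum_(i < m1 | (r <= i)%N) dx (xa i) (dx (xb i) f))
  + dx xc (dx xc f)
  + 2%:R *: (\sum_(j < n) dth (lshift n j) (dth (rshift n j) f)).

Definition superharmonic (r : nat) (k : int) (f : A1) : Prop :=
  component (lowset r) k f /\ Delta r f = 0.

Definition osp_irreducible1 (r : nat) (U : A1 -> Prop) : Prop :=
  irreducible osp (osp_act1 r) U.

(* Second family, on F[x_1, .., x_2n, theta_1, .., theta_m]: the even
   indices are fermionic and the odd ones bosonic. *)
Local Notation A2 := (superpoly F (n + n) (m1 + m1 + 1)).

Definition glE2 (T : {set 'I_(n + n)}) (a b : 'I_((m1 + m1 + 1) + (n + n))) :
    A2 -> A2 :=
  match split a, split b with
  | inl p, inl q => osc_ff p q
  | inl p, inr j => osc_fb T p j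
  | inr i, inl p => osc_bf T i p
  | inr i, inr j => osc_bb T i j
  end.

Definition osp_act2 (T : {set 'I_(n + n)})
    (X : 'M[F]_((m1 + m1 + 1) + (n + n))) (f : A2) : A2 := mx_act (glE2 T) X f.

Definition osp_irreducible2 (T : {set 'I_(n + n)}) (U : A2 -> Prop) : Prop :=
  irreducible osp (osp_act2 T) U.

End Osp.

(* Main.v *)
Require Import Defs.
From HB Require Import structures.
From Stdlib Require Import Classical_Prop.
From mathcomp Require Import all_boot all_order all_algebra.
From mathcomp.multinomials Require Import mpoly.
From mathcomp Require Import complex reals.
From mathcomp Require Import ring zify.

(** Both families are Fock spaces with operators a_I (raising) and b_I
    (lowering), and osp is the fixed part of gl under the form: lowering with
    the form, c_I = +- b_I', it is spanned by
    L_IJ = a_I c_J - eps s_IJ a_J c_I, where eps = 1 in the first family,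
    eps = -1 in the second one, and s_IJ is the super sign. Put
    Delta = sum c_I c_I', eta = sum a_I a_I', both zero if eps = -1, and call a
    vector harmonic if it is killed by Delta.

    The point is a Casimir identity: on harmonic vectors w of degree e,
    sum_K +- L_IK' L_KJ w is, up to L_IJ w and w, the vector
    nu a_I c_J w - eta c_I c_J w, which is a multiple of the harmonic
    projection T_I of a_I applied to c_J w. Hence an osp-stable space W of
    harmonic vectors satisfies T_I c_J W < W and c_J T_I W < W; applying all the
    T_I, resp. all the c_I, repeatedly to W gives a ladder of osp-stable spaces
    U_j with U_0 = W, and the sum of the eta^i U_j is stable under all a_I and
    c_I, so it is the whole Fock space if W <> 0. The eigenvalues of the Euler
    operator and of eta Delta then separate U_0 from the other summands. All
    constants met on the way are nonzero because the superdimension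
    +-(2 m1 + 1 - 2 n) is odd. *)

Set Implicit Arguments.
Unset Strict Implicit.
Unset Printing Implicit Defensive.

Import Order.TTheory GRing.Theory Num.Theory.

Local Open Scope ring_scope.

Lemma pchar0_intr_eq0 (F : fieldType) (z : int) :
  [pchar F] =i pred0 -> (z%:~R == 0 :> F) = (z == 0).
Proof.
move=> /pcharf0P F0; case: z => n; first by rewrite [_%:~R]/(n%:R) F0.
by rewrite NegzE mulrNz !oppr_eq0 [_%:~R]/(n.+1%:R) F0.
Qed.

(** * Linear identities by comparison of coefficients *)

Section LinearExpressions.
Variables (F : fieldType) (V : lmodType F).

(** Formal linear combinations of numbered vectors: an identity in [V] becomes one scalar identity
    per vector, within reach of [ring]. *)
Inductive linexp :=
  | LVar of nat | LZero | LAdd of linexp & linexp | LOpp of linexp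
  | LScale of F & linexp.

Fixpoint leval (env : seq V) (e : linexp) : V :=
  match e with
  | LVar i => env`_i
  | LZero => 0
  | LAdd e1 e2 => leval env e1 + leval env e2
  | LOpp e1 => - leval env e1
  | LScale k e1 => k *: leval env e1
  end.

Fixpoint lcoef (e : linexp) (i : nat) : F :=
  match e with
  | LVar j => if j == i then 1 else 0
  | LZero => 0
  | LAdd e1 e2 => lcoef e1 i + lcoef e2 i
  | LOpp e1 => - lcoef e1 i
  | LScale k e1 => k * lcoef e1 i
  end.

Lemma levalE env e : leval env e = \sum_(i < size env) lcoef e i *: env`_i.
Proof.
elim: e => [j||e1 IH1 e2 IH2|e IH|k e IH] /=.
- case: (ltnP j (size env)) => [lt_j|le_j].
    rewrite (bigD1 (Ordinal lt_j)) //= eqxx scale1r big1 ?addr0 // => i.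
    by rewrite -val_eqE eq_sym /= => /negPf->; rewrite scale0r.
  rewrite nth_default // big1 // => i _.
  by rewrite gtn_eqF ?scale0r // (leq_trans (ltn_ord i)).
- by rewrite big1 // => i _; rewrite scale0r.
- by rewrite IH1 IH2 -big_split; apply: eq_bigr => i _; rewrite scalerDl.
- by rewrite IH -sumrN; apply: eq_bigr => i _; rewrite scaleNr.
- by rewrite IH scaler_sumr; apply: eq_bigr => i _; rewrite scalerA.
Qed.

Fixpoint same_coefs (n : nat) (e1 e2 : linexp) : Prop :=
  if n is n'.+1 then lcoef e1 n' = lcoef e2 n' /\ same_coefs n' e1 e2 else True.

(** A sufficient criterion only, as the vectors of [env] may be linearly dependent. *)
Lemma leval_eq env e1 e2 :
  same_coefs (size env) e1 e2 -> leval env e1 = leval env e2.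
Proof.
rewrite !levalE => eq12; apply: eq_bigr => -[i lt_i] _ /=; congr (_ *: _).
elim: (size env) lt_i eq12 => //= n IHn; rewrite ltnS leq_eqVlt.
by case/orP=> [/eqP-> []|lt_i [_ /IHn]]; [|apply].
Qed.

End LinearExpressions.

(* Atoms are compared up to conversion: the same application of a linear map
   can appear through different coercion paths. *)
Ltac lin_index x env :=
  match env with
  | ?y :: _ => let _ := match goal with _ => unify x y end in constr:(0%N)
  | _ :: ?env' => let i := lin_index x env' in constr:(i.+1)
  end.
Ltac lin_atoms t env :=
  lazymatch t with
  | ?x + ?y => let env' := lin_atoms x env in lin_atoms y env'
  | - ?x => lin_atoms x env
  | _ *: ?x => lin_atoms x env
  | 0 => env
  | _ => match goal with
         | _ => let _ := lin_index t env in env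
         | _ => constr:(t :: env)
         end
  end.
Ltac lin_reify F t env :=
  lazymatch t with
  | ?x + ?y => let e1 := lin_reify F x env in let e2 := lin_reify F y env in
               constr:(LAdd e1 e2)
  | - ?x => let e := lin_reify F x env in constr:(LOpp e)
  | ?k *: ?x => let e := lin_reify F x env in constr:(LScale k e)
  | 0 => constr:(@LZero F)
  | _ => let i := lin_index t env in constr:(@LVar F i)
  end.
Ltac linear_comb F :=
  lazymatch goal with
  | |- @eq ?T ?x ?y =>
    let env0 := lin_atoms x (@nil T) in
    let env := lin_atoms y env0 in
    let e1 := lin_reify F x env in
    let e2 := lin_reify F y env in
    apply: (@leval_eq F _ env e1 e2);
    cbn [size same_coefs lcoef eqn eq_op]; rewrite /=;
    repeat split; try ring
  end.

(** * Subspaces, spans and eigenvectors *)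

Section Subspaces.
Variables (F : fieldType) (V : lmodType F).
Implicit Types (B W : V -> Prop).

Definition subspace W : Prop :=
  [/\ W 0, forall u v, W u -> W v -> W (u + v)
    & forall k v, W v -> W (k *: v)].

Lemma subspaceB W u v : subspace W -> W u -> W v -> W (u - v).
Proof.
by case=> _ WD WZ Wu Wv; apply: WD => //; rewrite -scaleN1r; apply: WZ.
Qed.

Lemma subspace_sum W (I : Type) (r : seq I) (f : I -> V) :
  subspace W -> (forall i, W (f i)) -> W (\sum_(i <- r) f i).
Proof.
by case=> W0 WD _ Wf; elim/big_rec: _ => // i v _ Wv; apply: WD.
Qed.

Lemma subspaceZ_inv W k v : subspace W -> k != 0 -> W (k *: v) -> W v.
Proof.
by case=> _ _ WZ k_n0 /(WZ k^-1); rewrite scalerA mulVf // scale1r.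
Qed.

Lemma in_span_mem B v : B v -> in_span B v.
Proof.
move=> Bv; exists 1%N, (fun=> 1), (fun=> v); split=> //.
by rewrite big_ord1 scale1r.
Qed.

(** Serves as induction on a span: with the preimage of a subspace under a linear map as [W],
    stability is reduced to generators. *)
Lemma in_span_sub B W v :
  subspace W -> (forall u, B u -> W u) -> in_span B v -> W v.
Proof.
move=> sW BW [k [x [b [Bb ->]]]]; apply: subspace_sum => // i.
by case: sW => _ _; apply; apply: BW.
Qed.

Lemma in_span_subspace B : subspace (in_span B).
Proof.
split.
- by exists 0%N, (fun=> 0), (fun=> 0); split; [case | rewrite big_ord0].
- move=> _ _ [k1 [x1 [b1 [Bb1 ->]]]] [k2 [x2 [b2 [Bb2 ->]]]].
  exists (k1 + k2)%N.
  exists (fun i => match split i with inl j => x1 j | inr j => x2 j end).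
  exists (fun i => match split i with inl j => b1 j | inr j => b2 j end); split.
    by move=> i; case: (split i).
  rewrite big_split_ord /=; congr (_ + _); apply: eq_bigr => i _.
    by rewrite (unsplitK (inl i)).
  by rewrite (unsplitK (inr i)).
- move=> y _ [k [x [b [Bb ->]]]]; exists k, (fun i => y * x i), b; split=> //.
  by rewrite scaler_sumr; apply: eq_bigr => i _; rewrite scalerA.
Qed.

Lemma preim_subspace (h : {linear V -> V}) W :
  subspace W -> subspace (fun v => W (h v)).
Proof.
case=> W0 WD WZ; split=> [|u v Wu Wv|k v Wv]; first by rewrite linear0.
  by rewrite linearD; apply: WD.
by rewrite linearZ; apply: WZ.
Qed.

(* Induction on the number of terms: if the last one has eigenvalue y != x,
   applying h - y to the sum removes it and multiplies the sum by x - y. *)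
Lemma eigen_in_span (h : {linear V -> V}) B x v :
  (forall b, B b -> exists y, h b = y *: b) ->
  in_span B v -> h v = x *: v -> in_span (fun b => B b /\ h b = x *: b) v.
Proof.
move=> eigB [k [z [b [Bb ->]]]].
have [S0 SD SZ] := in_span_subspace (fun b => B b /\ h b = x *: b).
elim: k z b Bb => [|k IHk] z b Bb; first by rewrite big_ord0.
have [y hy] := eigB _ (Bb ord_max).
rewrite big_ord_recr /=; set u := \sum_(i < k) _; set w := _ *: b ord_max => hv.
have hw : h w = y *: w by rewrite linearZ /= hy scalerA mulrC -scalerA.
have [eq_yx|ne_yx] := eqVneq y x.
  apply: SD; last by apply/SZ/in_span_mem; split; rewrite // hy eq_yx.
  apply: (IHk _ (fun i => b (widen_ord (leqnSn k) i))) => //.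
  by apply: (addIr (h w)); rewrite -linearD hv scalerDr hw eq_yx.
have e1 : h (u + w) - y *: (u + w) = (x - y) *: (u + w).
  by rewrite hv scalerBl.
have e2 : h (u + w) - y *: (u + w) = h u - y *: u.
  by rewrite linearD /= hw; linear_comb F.
have /(SZ (x - y)^-1) : in_span (fun b => B b /\ h b = x *: b) ((x - y) *: (u + w)).
  rewrite -e1 e2.
  have [t e3] : exists t : 'I_k -> F, h u - y *: u =
      \sum_(i < k) t i *: b (widen_ord (leqnSn k) i).
    have [Y hY] := fin_all_exists (fun i => eigB _ (Bb (widen_ord (leqnSn k) i))).
    exists (fun i => z (widen_ord (leqnSn k) i) * (Y i - y)).
    rewrite /u linear_sum scaler_sumr -sumrB; apply: eq_bigr => i _.
    by rewrite linearZ /= hY; linear_comb F.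
  rewrite e3; apply: (IHk _ (fun i => b (widen_ord (leqnSn k) i))) => //.
  by rewrite -e3 -e2 e1 linearZ /= hv !scalerA mulrC.
by rewrite scalerA mulVf ?scale1r // subr_eq0 eq_sym.
Qed.

End Subspaces.

(** * Oscillator algebras *)

Section OscillatorAlgebra.
Variables (F : fieldType) (V : lmodType F) (d : finType).
Variables (par : d -> bool) (inv : d -> d) (kap : d -> F) (eps : F).
Variables (a c : d -> {linear V -> V}).

Definition ssign (I J : d) : F := (-1) ^+ (par I && par J).
(** The Gram matrix of the form in a basis closed under duality. *)
Definition pairing (I J : d) : F := if J == inv I then kap I else 0.

Local Notation s := ssign.
Local Notation g := pairing.

(* [c I] is the lowering operator of index [inv I] up to sign, i.e. lowered by
   the form [kap]; [eps] is 1 (-1) if the form is supersymmetric (superskew) for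
   the parity [par] of the operators. *)
Record oscillator : Prop := Oscillator {
  osc_eps : eps = 1 \/ eps = -1;
  osc_invK : involutive inv;
  osc_par : forall I, par (inv I) = par I;
  osc_kap2 : forall I, kap I * kap I = 1;
  osc_kapV : forall I, kap (inv I) = eps * s I I * kap I;
  osc_aC : forall I J v, a I (a J v) = s I J *: a J (a I v);
  osc_cC : forall I J v, c I (c J v) = s I J *: c J (c I v);
  osc_ca : forall I J v, c I (a J v) = pairing I J *: v + s I J *: a J (c I v)
}.

(** By [osc_ca] and [osc_kap2], [kap K *: c K] is the lowering operator dual to [a (inv K)], so this
    is the degree operator. *)
Definition euler (v : V) : V := \sum_K kap K *: a (inv K) (c K v).
Definition laplace (v : V) : V := \sum_K kap K *: c (inv K) (c K v).
Definition square (v : V) : V := \sum_K kap K *: a (inv K) (a K v).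
Definition Lop (I J : d) (v : V) : V :=
  a I (c J v) - (eps * s I J) *: a J (c I v).
(** The superdimension: an index counts 1 if it is even and -1 if it is odd. *)
Definition sdim : F := \sum_K s K K.

Fact euler_is_linear : linear euler.
Proof.
move=> k u v; rewrite /euler scaler_sumr -big_split; apply: eq_bigr => K _ /=.
by rewrite !linearP /=; linear_comb F.
Qed.
HB.instance Definition _ := GRing.isLinear.Build F V V *:%R euler euler_is_linear.

Fact laplace_is_linear : linear laplace.
Proof.
move=> k u v; rewrite /laplace scaler_sumr -big_split; apply: eq_bigr => K _ /=.
by rewrite !linearP /=; linear_comb F.
Qed.
HB.instance Definition _ :=
  GRing.isLinear.Build F V V *:%R laplace laplace_is_linear.

Fact square_is_linear : linear square.
Proof.
move=> k u v; rewrite /square scaler_sumr -big_split; apply: eq_bigr => K _ /=.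
by rewrite !linearP /=; linear_comb F.
Qed.
HB.instance Definition _ :=
  GRing.isLinear.Build F V V *:%R square square_is_linear.

Fact Lop_is_linear I J : linear (Lop I J).
Proof. by move=> k u v; rewrite /Lop !linearP /=; linear_comb F. Qed.
HB.instance Definition _ I J :=
  GRing.isLinear.Build F V V *:%R (Lop I J) (@Lop_is_linear I J).

Lemma ssignC I J : s I J = s J I.
Proof. by rewrite /ssign andbC. Qed.

Lemma ssign2 I J : s I J * s I J = 1.
Proof. by rewrite /ssign -expr2 sqrr_sign. Qed.

Hypothesis osc : oscillator.

Let eps2 : eps * eps = 1.
Proof. by case: (osc_eps osc) => ->; rewrite ?mulrNN mulr1. Qed.

Lemma ssignVl I J : s (inv I) J = s I J.
Proof. by rewrite /ssign (osc_par osc). Qed.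

Lemma ssignVr I J : s I (inv J) = s I J.
Proof. by rewrite /ssign (osc_par osc). Qed.

Lemma pairing_sym I J : g J I = eps * s I J * g I J.
Proof.
rewrite /pairing; have [->|nJ] := eqVneq J (inv I).
  by rewrite (osc_invK osc) eqxx ssignVr (osc_kapV osc).
rewrite mulr0 ifN //; apply: contraNneq nJ => ->.
by rewrite (osc_invK osc).
Qed.

Lemma pairing_par I J : g I J != 0 -> par I = par J.
Proof.
rewrite /pairing; have [->|_] := eqVneq J (inv I); last by rewrite eqxx.
by rewrite (osc_par osc).
Qed.

Lemma kapVM J : kap (inv J) * kap J = eps * s J J.
Proof. by rewrite (osc_kapV osc) -mulrA (osc_kap2 osc) mulr1. Qed.

(** Contractions of the form with its inverse, in the four index positions that occur below; [kap]
    is its own inverse up to the symmetry sign [eps * s J J]. *)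
Lemma contract1 J (f : d -> V) :
  \sum_K (kap K * g K J) *: f K = f (inv J).
Proof.
rewrite (bigD1 (inv J)) //= big1 ?addr0.
  by rewrite /pairing (osc_invK osc) eqxx (osc_kap2 osc) scale1r.
move=> K nK; rewrite /pairing ifN ?mulr0 ?scale0r //.
by apply: contraNneq nK => ->; rewrite (osc_invK osc).
Qed.

Lemma contract2 J (f : d -> V) :
  \sum_K (kap K * g (inv K) J) *: f K = (eps * s J J) *: f J.
Proof.
rewrite (bigD1 J) //= big1 ?addr0.
  by rewrite /pairing (osc_invK osc) eqxx mulrC kapVM.
move=> K nK; rewrite /pairing ifN ?mulr0 ?scale0r //.
by rewrite (osc_invK osc) eq_sym.
Qed.

Lemma contract3 J (f : d -> V) :
  \sum_K (kap K * g J K) *: f K = (eps * s J J) *: f (inv J).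
Proof.
rewrite (bigD1 (inv J)) //= big1 ?addr0.
  by rewrite /pairing eqxx kapVM.
by move=> K nK; rewrite /pairing ifN ?mulr0 ?scale0r.
Qed.

Lemma contract4 J (f : d -> V) :
  \sum_K (kap K * g J (inv K)) *: f K = f J.
Proof.
rewrite (bigD1 J) //= big1 ?addr0.
  by rewrite /pairing eqxx (osc_kap2 osc) scale1r.
move=> K nK; rewrite /pairing ifN ?mulr0 ?scale0r //.
by apply: contraNneq nK => /(can_inj (osc_invK osc))->.
Qed.

Lemma linear_sumZ (h : {linear V -> V}) (k : d -> F) (f : d -> V) :
  h (\sum_K k K *: f K) = \sum_K k K *: h (f K).
Proof. by rewrite linear_sum; apply: eq_bigr => K _; rewrite linearZ. Qed.

Lemma sum_inv (f : d -> V) :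
  \sum_K kap K *: f K = \sum_K kap K *: ((eps * s K K) *: f (inv K)).
Proof.
rewrite (reindex_inj (can_inj (osc_invK osc))) /=; apply: eq_bigr => K _.
by rewrite (osc_kapV osc) scalerA mulrC.
Qed.

(** [a J] can be contracted with either factor of [laplace]; the two contributions, [c J v] and
    [eps *: c J v], cancel if [eps = -1]. *)
Lemma laplace_a J v : laplace (a J v) = a J (laplace v) + (1 + eps) *: c J v.
Proof.
have -> : laplace (a J v) = \sum_K (kap K * g K J) *: c (inv K) v
    + \sum_K (kap K * g (inv K) J) *: (s K J *: c K v)
    + \sum_K kap K *: a J (c (inv K) (c K v)).
  rewrite -!big_split; apply: eq_bigr => K _ /=.
  rewrite !(osc_ca osc, linearD, linearZ) /= ssignVl.
  linear_comb F.
  ring: (ssign2 K J).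
rewrite contract1 contract2 (osc_invK osc) linear_sumZ.
rewrite scalerA -mulrA ssign2.
by linear_comb F.
Qed.

Lemma laplace_c J v : laplace (c J v) = c J (laplace v).
Proof.
rewrite /laplace linear_sumZ; apply: eq_bigr => K _.
rewrite (osc_cC osc K J) linearZ /= (osc_cC osc _ J) ssignVl.
by rewrite (scalerA (s K J)) ssign2 scale1r.
Qed.

Lemma square_a J v : square (a J v) = a J (square v).
Proof.
rewrite /square linear_sumZ; apply: eq_bigr => K _.
rewrite (osc_aC osc K J) linearZ /= (osc_aC osc _ J) ssignVl.
by rewrite (scalerA (s K J)) ssign2 scale1r.
Qed.

Lemma c_square J v : c J (square v) = square (c J v) + (1 + eps) *: a J v.
Proof.
have -> : c J (square v) = \sum_K (kap K * g J (inv K)) *: a K v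
    + \sum_K (kap K * g J K) *: (s J K *: a (inv K) v)
    + \sum_K kap K *: a (inv K) (a K (c J v)).
  rewrite linear_sum -!big_split; apply: eq_bigr => K _ /=.
  rewrite linearZ /= !(osc_ca osc, linearD, linearZ) /= ssignVr.
  linear_comb F.
  ring: (ssign2 J K) (ssign2 K J).
rewrite contract3 contract4 /square ssignVr (osc_invK osc) scalerA -mulrA ssign2.
by linear_comb F.
Qed.

Lemma euler_a J v : euler (a J v) = a J (euler v) + a J v.
Proof.
have -> : euler (a J v) = \sum_K (kap K * g K J) *: a (inv K) v
    + \sum_K kap K *: a J (a (inv K) (c K v)).
  rewrite -!big_split; apply: eq_bigr => K _ /=.
  rewrite !(osc_ca osc, linearD, linearZ) /= (osc_aC osc _ J) ssignVl.
  linear_comb F.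
  ring: (ssign2 J K) (ssign2 K J).
by rewrite contract1 (osc_invK osc) linear_sumZ addrC.
Qed.

Lemma euler_c J v : euler (c J v) = c J (euler v) - c J v.
Proof.
have -> : c J (euler v) = \sum_K (kap K * g J (inv K)) *: c K v + euler (c J v).
  rewrite linear_sum -!big_split; apply: eq_bigr => K _ /=.
  rewrite linearZ /= !(osc_ca osc, linearD, linearZ) /= (osc_cC osc J) !linearZ /=.
  rewrite ssignVr.
  linear_comb F.
  ring: (ssign2 J K) (ssign2 K J).
by rewrite contract4 addrC addKr.
Qed.

Lemma euler_square v : euler (square v) = square (euler v) + 2%:R *: square v.
Proof.
have -> : square (euler v) = \sum_K kap K *: a (inv K) (a K (euler v)) by [].
rewrite /square linear_sum scaler_sumr -big_split; apply: eq_bigr => K _ /=.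
rewrite linearZ /= !euler_a !linearD /=.
by linear_comb F.
Qed.

(** Normal ordering: the commutators add up to the superdimension, and the reordered part is the
    Euler operator reindexed by [inv]. *)
Lemma trace_ca v :
  \sum_K kap K *: c (inv K) (a K v) = (eps * sdim) *: v + eps *: euler v.
Proof.
have -> : eps *: euler v = \sum_K kap K *: (s K K *: a K (c (inv K) v)).
  rewrite /euler (sum_inv (fun K => a (inv K) (c K v))) scaler_sumr.
  apply: eq_bigr => K _; rewrite (osc_invK osc).
  by linear_comb F; ring: eps2.
rewrite /sdim mulr_sumr scaler_suml -big_split; apply: eq_bigr => K _ /=.
rewrite (osc_ca osc) /pairing (osc_invK osc) eqxx ssignVl -kapVM.
by linear_comb F.
Qed.

(** For [eps = 1] this is the sl2 relation between [laplace], [square] and a shifted Euler operator;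
    for [eps = -1] both commutator terms vanish. *)
Lemma laplace_square v : laplace (square v) =
  square (laplace v)
  + ((1 + eps) * (1 + eps)) *: euler v + ((1 + eps) * (eps * sdim)) *: v.
Proof.
have -> : laplace (square v) = square (laplace v)
    + (1 + eps) *: (\sum_K kap K *: a (inv K) (c K v))
    + (1 + eps) *: (\sum_K kap K *: c (inv K) (a K v)).
  rewrite /laplace linear_sum !scaler_sumr -!big_split; apply: eq_bigr => K _ /=.
  rewrite linearZ /= !(c_square, linearD, linearZ) /=.
  by linear_comb F.
rewrite trace_ca -/(euler v).
by case: (osc_eps osc) => ->; linear_comb F.
Qed.

(** Exchanging the two factors of each pair produces the symmetry sign of the form; for [eps = -1]
    this forces [square] to vanish once 2 is invertible. *)
Lemma square_sym v : eps *: square v = square v.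
Proof.
rewrite {2}/square (sum_inv (fun K => a (inv K) (a K v))) scaler_sumr.
apply: eq_bigr => K _; rewrite (osc_invK osc) (osc_aC osc K) ssignVr.
by linear_comb F; ring: (ssign2 K K) eps2.
Qed.

Lemma laplace_sym v : eps *: laplace v = laplace v.
Proof.
rewrite {2}/laplace (sum_inv (fun K => c (inv K) (c K v))) scaler_sumr.
apply: eq_bigr => K _; rewrite (osc_invK osc) (osc_cC osc K) ssignVr.
by linear_comb F; ring: (ssign2 K K) eps2.
Qed.

Lemma Lop_split k I J v :
  k *: a I (c J v) + (- (eps * s I J) * k) *: a J (c I v) = k *: Lop I J v.
Proof. by rewrite /Lop; linear_comb F. Qed.

Lemma Lop_sym I J v : Lop J I v = - (eps * s I J) *: Lop I J v.
Proof.
by rewrite /Lop [s J I]ssignC; linear_comb F; ring: eps2 (ssign2 I J).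
Qed.

(** The commutators contribute [(1 + eps) *: (c I (c J v) - (eps * s I J) *: c J (c I v))]; for
    [eps = 1] the bracket is zero, for [eps = -1] the factor. *)
Lemma Lop_laplace I J v : laplace (Lop I J v) = Lop I J (laplace v).
Proof.
rewrite linearB linearZ /= !laplace_a !laplace_c (osc_cC osc I J) /Lop.
by case: (osc_eps osc) => ->; linear_comb F; ring: (ssign2 I J).
Qed.

Lemma Lop_square I J v : Lop I J (square v) = square (Lop I J v).
Proof.
rewrite /Lop !c_square !(linearD, linearN, linearZ) /= !square_a.
rewrite (osc_aC osc I J).
by case: (osc_eps osc) => ->; linear_comb F; ring: (ssign2 I J).
Qed.

Lemma Lop_euler I J v : euler (Lop I J v) = Lop I J (euler v).
Proof.
rewrite linearB linearZ /= !euler_a !euler_c /Lop !linearB /=.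
by linear_comb F.
Qed.

Lemma pairing_ssign K I J : g K I * s I J = g K I * s K J.
Proof.
have [->|/pairing_par parKI] := eqVneq (g K I) 0; first by rewrite !mul0r.
by rewrite /ssign parKI.
Qed.

(** The [a K] transform under [Lop I J] as a basis of the natural module of osp; [s I K * s J K] is
    the sign of moving [Lop I J] past [a K]. *)
Lemma Lop_a I J K v : Lop I J (a K v) =
  g J K *: a I v - (eps * s I J * g I K) *: a J v
  + (s I K * s J K) *: a K (Lop I J v).
Proof.
rewrite /Lop !(osc_ca osc) !(linearD, linearN, linearZ) /=.
rewrite (osc_aC osc I K) (osc_aC osc J K).
by linear_comb F.
Qed.

(** Same law as for [a K], since the form identifies the natural module with its dual. *)
Lemma Lop_c I J K v : Lop I J (c K v) =
  g J K *: c I v - (eps * s I J * g I K) *: c J v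
  + (s I K * s J K) *: c K (Lop I J v).
Proof.
have ac I' v' : a I' (c K v') = s I' K *: (c K (a I' v') - g K I' *: v').
  by rewrite (osc_ca osc) (ssignC K); linear_comb F; ring: (ssign2 I' K).
rewrite /Lop (osc_cC osc J K) (osc_cC osc I K) !linearB !linearZ /= !ac.
rewrite (pairing_sym J K) (pairing_sym I K).
have := pairing_ssign J K I; have := pairing_ssign I K J.
rewrite (ssignC K I) (ssignC K J) (ssignC J I) => e1 e2.
linear_comb F.
- transitivity (- eps * (s I K * s I K) * (g I K * s J K)); first by ring.
  by rewrite e1 ssign2; ring.
- transitivity (eps * eps * (s J K * s J K) * s I J * (g J K * s I K)).
    by ring.
  by rewrite e2 ssign2 eps2; ring: (ssign2 I J).
Qed.

(** * The Casimir identity *)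

Section Harmonic.

Variables (e : F) (w : V).
Hypotheses (euler_w : euler w = e *: w) (laplace_w : laplace w = 0).

(** The product of the two-term operators gives four sums; in each one the contracted pair is
    brought together until [trace_ca], [laplace], [square] or [euler] applies. *)
Lemma Casimir I J : \sum_K kap K *: Lop I (inv K) (Lop K J w) =
  eps *: ((sdim + 2%:R * (e - 1) - 2%:R * eps) *: a I (c J w)
          - square (c I (c J w)))
  - (eps * (e - 1)) *: Lop I J w + (e * g I J) *: w.
Proof.
have sum4 (f1 f2 f3 f4 : d -> V) :
    \sum_K (f1 K - f2 K - f3 K + f4 K) =
    \sum_K f1 K - \sum_K f2 K - \sum_K f3 K + \sum_K f4 K.
  by rewrite !(big_split, sumrN).
have -> : \sum_K kap K *: Lop I (inv K) (Lop K J w) =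
    \sum_K kap K *: a I (c (inv K) (a K (c J w)))
  - \sum_K kap K *: ((eps * s K J) *: a I (c (inv K) (a J (c K w))))
  - \sum_K kap K *: ((eps * s I K) *: a (inv K) (c I (a K (c J w))))
  + \sum_K kap K *: ((s I K * s K J) *: a (inv K) (c I (a J (c K w)))).
  rewrite -sum4; apply: eq_bigr => K _.
  rewrite /Lop !(linearD, linearN, linearZ) /= ssignVr.
  by linear_comb F; ring: eps2.
have -> : \sum_K kap K *: a I (c (inv K) (a K (c J w))) =
    (eps * (sdim + e - 1)) *: a I (c J w).
  rewrite -linear_sumZ trace_ca euler_c euler_w !(linearD, linearN, linearZ) /=.
  by linear_comb F.
(* Moving [c (inv K)] past [a J] leaves a contraction and a multiple of [a I (a J (laplace w))],
   which is zero. *)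
have -> : \sum_K kap K *: ((eps * s K J) *: a I (c (inv K) (a J (c K w)))) =
    a I (c J w) + eps *: a I (a J (laplace w)).
  transitivity (\sum_K (kap K * g (inv K) J) *: ((eps * s K J) *: a I (c K w))
    + eps *: \sum_K kap K *: a I (a J (c (inv K) (c K w)))).
    rewrite scaler_sumr -big_split; apply: eq_bigr => K _ /=.
    rewrite (osc_ca osc) ssignVl !(linearD, linearZ) /=.
    by linear_comb F; ring: (ssign2 K J).
  rewrite contract2 -!linear_sumZ.
  by linear_comb F; ring: (ssign2 J J) eps2.
have -> : \sum_K kap K *: ((eps * s I K) *: a (inv K) (c I (a K (c J w)))) =
    a I (c J w) + eps *: square (c I (c J w)).
  transitivity (\sum_K (kap K * g I K) *: ((eps * s I K) *: a (inv K) (c J w))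
    + eps *: \sum_K kap K *: a (inv K) (a K (c I (c J w)))).
    rewrite scaler_sumr -big_split; apply: eq_bigr => K _ /=.
    rewrite (osc_ca osc) !(linearD, linearZ) /=.
    by linear_comb F; ring: (ssign2 I K).
  rewrite contract3 (osc_invK osc) ssignVr.
  by linear_comb F; ring: (ssign2 I I) eps2.
(* Here the pair forms Euler operators at [w] and at [c I w], of degrees [e] and [e - 1]. *)
have -> : \sum_K kap K *: ((s I K * s K J) *: a (inv K) (c I (a J (c K w)))) =
    (e * g I J) *: w + (s I J * (e - 1)) *: a J (c I w).
  transitivity (g I J *: euler w + s I J *: a J (euler (c I w))).
    rewrite /euler linear_sumZ !scaler_sumr -big_split; apply: eq_bigr => K _ /=.
    rewrite (osc_ca osc) !(linearD, linearZ) /= (osc_aC osc _ J) (osc_cC osc I K).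
    rewrite !linearZ /= ssignVl.
    (* The signs [s I K] and [s K J] agree when [I] and [J] have equal parity; otherwise the form
       vanishes at them. *)
    have [gIJ|/pairing_par parIJ] := eqVneq (g I J) 0.
      by rewrite gIJ; linear_comb F; ring: (ssign2 I K) (ssign2 K J).
    rewrite (_ : s K J = s I K); last by rewrite /ssign parIJ andbC.
    by linear_comb F; ring: (ssign2 I K).
  by rewrite euler_c euler_w linearB !linearZ /=; linear_comb F.
rewrite laplace_w !linear0 /Lop.
by case: (osc_eps osc) => ->; linear_comb F.
Qed.

End Harmonic.

(** * Harmonic vectors and the passage to neighbouring degrees *)

Definition harmonic (e : F) (v : V) : Prop :=
  euler v = e *: v /\ laplace v = 0.

Definition Lop_stable (W : V -> Prop) : Prop :=
  subspace W /\ forall I J v, W v -> W (Lop I J v).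

(** For [eps = 1] the constant is forced by [laplace (raise e I v) = 0]; for [eps = -1] it is read
    off from [Casimir], where [nu (e - 1)] appears. *)
Definition nu (e : F) : F := sdim + 2%:R * e - 2%:R * eps.

(* On harmonic vectors of degree [e] this is [nu e] times the harmonic
   projection of [a I]. *)
Definition raise (e : F) (I : d) (v : V) : V :=
  nu e *: a I v - square (c I v).

Fact raise_is_linear e I : linear (raise e I).
Proof. by move=> k u v; rewrite /raise !linearP /=; linear_comb F. Qed.
HB.instance Definition _ e I :=
  GRing.isLinear.Build F V V *:%R (raise e I) (@raise_is_linear e I).

Definition up (e : F) (W : V -> Prop) : V -> Prop :=
  in_span (fun v => exists I u, W u /\ v = raise e I u).

Definition down (W : V -> Prop) : V -> Prop :=
  in_span (fun v => exists I u, W u /\ v = c I u).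

Lemma harmonic_subspace e : subspace (harmonic e).
Proof.
split=> [|u v [eu lu] [ev lv]|k v [ev lv]].
- by split; rewrite ?linear0 ?scaler0.
- by split; rewrite linearD /= ?eu ?ev ?lu ?lv ?scalerDr ?addr0.
- by split; rewrite linearZ /= ?ev ?lv ?scaler0 // !scalerA mulrC.
Qed.

Lemma harmonic_Lop e I J v : harmonic e v -> harmonic e (Lop I J v).
Proof.
by case=> ev lv; split; rewrite ?Lop_euler ?Lop_laplace ?ev ?lv ?linearZ ?linear0.
Qed.

Lemma harmonic_c e I v : harmonic e v -> harmonic (e - 1) (c I v).
Proof.
case=> ev lv; split; last by rewrite laplace_c lv linear0.
by rewrite euler_c ev linearZ /=; linear_comb F.
Qed.

Lemma square_eps v : eps = -1 -> 2%:R != 0 :> F -> square v = 0.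
Proof.
move=> epsN n2; have := square_sym v; rewrite epsN scaleN1r => sqN.
have : 2%:R *: square v = square v - - square v by linear_comb F.
by rewrite sqN subrr => /eqP; rewrite scaler_eq0 (negPf n2) /= => /eqP.
Qed.

Lemma laplace_eps v : eps = -1 -> 2%:R != 0 :> F -> laplace v = 0.
Proof.
move=> epsN n2; have := laplace_sym v; rewrite epsN scaleN1r => lapN.
have : 2%:R *: laplace v = laplace v - - laplace v by linear_comb F.
by rewrite lapN subrr => /eqP; rewrite scaler_eq0 (negPf n2) /= => /eqP.
Qed.

Lemma harmonic_raise e I v : harmonic e v -> harmonic (e + 1) (raise e I v).
Proof.
move=> hv; have [ev lv] := hv; have [ecv lcv] := harmonic_c I hv; split.
  rewrite /raise linearB linearZ /= euler_a euler_square ev ecv !linearZ /=.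
  by linear_comb F.
rewrite /raise linearB linearZ /= laplace_a laplace_square ecv lcv lv !linear0 /nu.
by case: (osc_eps osc) => ->; linear_comb F.
Qed.

(** [Casimir] writes [eps] times this vector through [w], [Lop I J w] and products of two [Lop] at
    [w], all of which stay in [W]. *)
Lemma raise_c_stable e W : Lop_stable W -> (forall w, W w -> harmonic e w) ->
  forall I J w, W w -> W (raise (e - 1) I (c J w)).
Proof.
move=> [sW LW] hW I J w Ww; have [ew lw] := hW w Ww; have [_ WD WZ] := sW.
have eqw : eps *: raise (e - 1) I (c J w) =
    \sum_K kap K *: Lop I (inv K) (Lop K J w)
    + (eps * (e - 1)) *: Lop I J w - (e * g I J) *: w.
  by rewrite (Casimir ew lw) /raise /nu; linear_comb F.
have : W (eps *: raise (e - 1) I (c J w)).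
  rewrite eqw; apply: subspaceB => //; last exact: WZ.
  apply: WD; last by apply/WZ/LW.
  by apply: subspace_sum => // K; apply/WZ/LW/LW.
by apply: subspaceZ_inv => //; case: (osc_eps osc) => ->; rewrite ?oppr_eq0 oner_eq0.
Qed.

(* For [eps = 1] this is [raise_c_stable] modulo the [Lop]; for [eps = -1] the
   term [square] vanishes, so [raise_c_stable] already gives [a I (c J w)]. *)
Lemma c_raise_stable e W : 2%:R != 0 :> F -> nu (e - 1) != 0 ->
  Lop_stable W -> (forall w, W w -> harmonic e w) ->
  forall I J w, W w -> W (c I (raise e J w)).
Proof.
move=> n2 nu_n0 stW hW I J w Ww; have [[_ WD WZ] LW] := stW.
have Wrc := raise_c_stable stW hW I J Ww.
have [eps1|epsN] := osc_eps osc.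
  have -> : c I (raise e J w) = raise (e - 1) I (c J w) - nu e *: Lop I J w
      + (nu e * g I J) *: w.
    rewrite /raise /Lop /nu !(linearD, linearN, linearZ) /= (osc_ca osc).
    by rewrite c_square eps1; linear_comb F.
  apply: (WD); last exact: WZ.
  exact: subspaceB (proj1 stW) Wrc (WZ _ _ (LW _ _ _ Ww)).
have Wac : W (a I (c J w)).
  apply: (subspaceZ_inv (proj1 stW) nu_n0).
  by move: Wrc; rewrite /raise (square_eps _ epsN n2) subr0.
have -> : c I (raise e J w) = nu e *: Lop I J w - nu e *: a I (c J w)
    + (nu e * g I J) *: w.
  rewrite /raise /Lop /nu !(linearD, linearN, linearZ) /= (osc_ca osc).
  by rewrite (square_eps _ epsN n2) linear0 epsN; linear_comb F.
apply: (WD); last exact: WZ.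
exact: subspaceB (proj1 stW) (WZ _ _ (LW _ _ _ Ww)) (WZ _ _ Wac).
Qed.

Lemma Lop_raise e I J K v : Lop I J (raise e K v) =
  g J K *: raise e I v - (eps * s I J * g I K) *: raise e J v
  + (s I K * s J K) *: raise e K (Lop I J v).
Proof.
rewrite /raise [LHS]linearB linearZ /= Lop_square Lop_a Lop_c.
by rewrite !(linearD, linearN, linearZ) /=; linear_comb F.
Qed.

(** Stability of the span only needs that the [T K] transform as the natural module, which both
    [raise e K] and [c K] do. *)
Lemma span_Lop_stable (T : d -> {linear V -> V}) W :
  (forall I J K v, Lop I J (T K v) = g J K *: T I v
     - (eps * s I J * g I K) *: T J v + (s I K * s J K) *: T K (Lop I J v)) ->
  Lop_stable W -> Lop_stable (in_span (fun v => exists I u, W u /\ v = T I u)).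
Proof.
move=> LT [sW LW]; set B := fun v => _.
have sB := in_span_subspace B; split=> // I J v.
have [_ BD BZ] := sB.
apply: (in_span_sub (preim_subspace (Lop I J) sB)) => _ [K [u [Wu ->]]].
have BT L w : W w -> in_span B (T L w).
  by move=> Ww; apply: in_span_mem; exists L, w.
rewrite /= LT; apply: (BD); last by apply/BZ/BT/LW.
by apply: subspaceB => //; apply/BZ/BT.
Qed.

Lemma up_stable e W : Lop_stable W -> Lop_stable (up e W).
Proof. exact: (span_Lop_stable (fun I J K v => Lop_raise e I J K v)). Qed.

Lemma down_stable W : Lop_stable W -> Lop_stable (down W).
Proof. exact: span_Lop_stable Lop_c. Qed.

(** * The ladder generated by an osp-stable space of harmonic vectors *)

Section Layers.

Variables (e0 : F) (W : V -> Prop).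
Hypotheses (F0 : [pchar F] =i pred0).
Hypothesis odd_degree : forall z : int, sdim + 2%:R * (e0 + z%:~R) != 0.
Hypotheses (stW : Lop_stable W) (harmW : forall w, W w -> harmonic e0 w).

Let n2 : 2%:R != 0 :> F.
Proof. by have /pcharf0P-> := F0. Qed.

(** This is the quantity of [odd_degree] with [z - eps] in place of [z]. *)
Let nu_n0 (z : int) : nu (e0 + z%:~R) != 0.
Proof.
rewrite /nu; have [k ->] : exists k : int, eps = k%:~R.
  by case: (osc_eps osc) => ->; [exists 1 | exists (-1)]; rewrite ?mulrN1z.
have := odd_degree (z - k); rewrite intrB; apply: contraNN => /eqP <-.
by apply/eqP; ring.
Qed.

Fixpoint up_layer (n : nat) : V -> Prop :=
  if n is n'.+1 then up (e0 + n'%:R) (up_layer n') else W.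

(** [Negz n] stands for [-(n + 1)], hence the [n.+1] steps down. *)
Definition layer (z : int) : V -> Prop :=
  match z with Posz n => up_layer n | Negz n => iter n.+1 down W end.

Lemma layerP z : Lop_stable (layer z) /\
  forall v, layer z v -> harmonic (e0 + z%:~R) v.
Proof.
have up_harm e U : (forall v, U v -> harmonic e v) ->
    forall v, up e U v -> harmonic (e + 1) v.
  move=> hU v; apply: (in_span_sub (harmonic_subspace (e + 1))) => _ [I [u [Uu ->]]].
  exact/harmonic_raise/hU.
have down_harm e U : (forall v, U v -> harmonic e v) ->
    forall v, down U v -> harmonic (e - 1) v.
  move=> hU v; apply: (in_span_sub (harmonic_subspace (e - 1))) => _ [I [u [Uu ->]]].
  exact/harmonic_c/hU.
case: z => n /=.
  elim: n => [|n [IHst IHh]] /=; first by rewrite addr0.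
  split; first exact: up_stable.
  by move=> v /(up_harm (e0 + n%:R) _ IHh); rewrite -addrA natr1.
have : Lop_stable (iter n.+1 down W) /\
    forall v, iter n.+1 down W v -> harmonic (e0 - n.+1%:R) v.
  elim: n => [|n [IHst IHh]].
    by split; [apply: down_stable | apply: down_harm].
  split; first exact: (down_stable IHst).
  by move=> v /(down_harm _ _ IHh); rewrite -addrA -opprD natr1.
by rewrite NegzE mulrNz.
Qed.

(** From a positive layer, [c I] undoes the last [up] by [c_raise_stable]; from the others it is a
    step of [down]. *)
Lemma layer_c z I v : layer z v -> layer (z - 1) (c I v).
Proof.
case: z => [[|n]|n].
- by move=> Wv; apply: in_span_mem; exists I, v.
- have [stn hn] := layerP n; have -> : n.+1%:Z - 1 = n.
    by rewrite intS addrC addKr.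
  apply: (in_span_sub (preim_subspace (c I) (proj1 stn))) => _ [J [u [Wu ->]]].
  apply: c_raise_stable stn hn _ _ _ Wu => //.
  by have := nu_n0 (n%:Z - 1); rewrite intrB addrA.
- have -> : Negz n - 1 = Negz n.+1 by rewrite !NegzE -opprD -PoszD addn1.
  by move=> Wv; apply: in_span_mem; exists I, v.
Qed.

(** Mirror image of [layer_c]: from a negative layer, [raise] undoes the last [down] by
    [raise_c_stable]. *)
Lemma layer_raise z I v : layer z v -> layer (z + 1) (raise (e0 + z%:~R) I v).
Proof.
case: z => [n|n].
  by rewrite -PoszD addn1 => Wv; apply: in_span_mem; exists I, v.
have -> : Negz n + 1 = - n%:Z by rewrite NegzE intS opprD addrAC addNr add0r.
have [stn hn] : Lop_stable (layer (- n%:Z)) /\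
   forall v, layer (- n%:Z) v -> harmonic (e0 - n%:R) v.
  by have := layerP (- n%:Z); rewrite mulrNz.
(* For [n = 0] this layer is [W], outside the [Negz] branch; iterates of [down] describe both cases
   uniformly. *)
have lN : layer (- n%:Z) = iter n down W by case: (n).
move: stn hn; rewrite lN => stn hn.
apply: (in_span_sub (preim_subspace (raise _ I) (proj1 stn))) => _ [J [u [Wu ->]]].
have -> : e0 + (Negz n)%:~R = e0 - n%:R - 1.
  by rewrite NegzE mulrNz -addrA -opprD natr1.
exact: raise_c_stable stn hn _ _ _ Wu.
Qed.

Definition layer_gen (v : V) : Prop :=
  exists z i u, layer z u /\ v = iter i square u.

Definition layers : V -> Prop := in_span layer_gen.

Lemma layers_mem z i u : layer z u -> layers (iter i square u).
Proof. by move=> lu; apply: in_span_mem; exists z, i, u. Qed.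

Lemma iter_square_linear i k u v :
  iter i square (k *: u + v) = k *: iter i square u + iter i square v.
Proof. by elim: i => //= i ->; rewrite linearP. Qed.

Lemma a_iter_square I i v : a I (iter i square v) = iter i square (a I v).
Proof. by elim: i => //= i <-; rewrite square_a. Qed.

(** The commutator of [c I] with [square] commutes with [square], so it is counted [i] times; at
    [i = 0] the exponent [i.-1] is harmless because its coefficient is zero. *)
Lemma c_iter_square I i v : c I (iter i square v) =
  iter i square (c I v) + (i%:R * (1 + eps)) *: iter i.-1 square (a I v).
Proof.
elim: i => [|i IHi] /=; first by rewrite mul0r scale0r addr0.
rewrite c_square IHi linearD linearZ /= -a_iter_square.
case: i {IHi} => [|i] /=; first by linear_comb F.
by rewrite -!a_iter_square square_a -[i.+2%:R]natr1; linear_comb F.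
Qed.

(** Since [nu] is nonzero, [a I u] is a combination of [raise], one layer up, and of
    [square (c I u)], the [square] of a vector one layer down. *)
Lemma layers_iter_a z I i u : layer z u -> layers (iter i square (a I u)).
Proof.
move=> lu; have [sL LD LZ] := in_span_subspace layer_gen.
have -> : a I u = (nu (e0 + z%:~R))^-1 *: raise (e0 + z%:~R) I u
    + (nu (e0 + z%:~R))^-1 *: square (c I u).
  rewrite /raise; linear_comb F.
  by have := nu_n0 z; move: (nu _) => t t0; field.
rewrite iter_square_linear; apply: LD.
  exact/LZ/layers_mem/layer_raise.
have := iter_square_linear i (nu (e0 + z%:~R))^-1 (square (c I u)) 0.
have -> : iter i square 0 = 0 by elim: (i) => //= j ->; rewrite linear0.
rewrite !addr0 => ->; apply: LZ; rewrite -iterSr.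
exact/layers_mem/layer_c/lu.
Qed.

Lemma layers_a I v : layers v -> layers (a I v).
Proof.
apply: (in_span_sub (preim_subspace (a I) (in_span_subspace _))).
by move=> _ [z [i [u [lu ->]]]]; rewrite a_iter_square; apply: layers_iter_a lu.
Qed.

Lemma layers_c I v : layers v -> layers (c I v).
Proof.
apply: (in_span_sub (preim_subspace (c I) (in_span_subspace _))).
move=> _ [z [i [u [lu ->]]]]; rewrite c_iter_square.
have [_ LD LZ] := in_span_subspace layer_gen.
apply: LD; first exact/layers_mem/layer_c/lu.
exact/LZ/layers_iter_a/lu.
Qed.

Lemma euler_iter_square e i u : euler u = e *: u ->
  euler (iter i square u) = (e + 2%:R * i%:R) *: iter i square u.
Proof.
move=> eu; elim: i => [|i IHi] /=; first by rewrite mulr0 addr0.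
by rewrite euler_square IHi linearZ /= -natr1; linear_comb F.
Qed.

(** The standard sl2 computation, by induction with [laplace_square]. *)
Lemma square_laplace_iter e i u : harmonic e u ->
  square (laplace (iter i square u)) =
  ((1 + eps) * i%:R * ((1 + eps) * (e + i%:R - 1) + eps * sdim))
    *: iter i square u.
Proof.
case=> eu lu; elim: i => [|i IHi] /=.
  by rewrite lu linear0 mulr0 mul0r scale0r.
rewrite laplace_square IHi !linearD !linearZ /= (euler_iter_square _ eu).
by rewrite linearZ /= -natr1; linear_comb F.
Qed.

Hypothesis irr : forall Z : V -> Prop, subspace Z ->
  (forall I v, Z v -> Z (a I v)) -> (forall I v, Z v -> Z (c I v)) ->
  (exists2 v, Z v & v != 0) -> forall v, Z v.

(** The layers exhaust the space by [irr], so [v] is a combination of generators; two eigenvalue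
    projections leave only those with [z = 0] and [i = 0], which lie in [W]. *)
Lemma harmonic_sub w0 : W w0 -> w0 != 0 -> forall v, harmonic e0 v -> W v.
Proof.
move=> Ww0 w0_n0 v [ev lv].
have sL : subspace layers := in_span_subspace _.
have Lv : layers v.
  apply: irr => //; [exact: layers_a|exact: layers_c|].
  by exists w0 => //; apply: (@layers_mem 0 0).
pose sqlap : {linear V -> V} := square \o laplace.
(* First projection: the generators are Euler eigenvectors and [v] has degree [e0]. *)
have Lv1 : in_span (fun x => layer_gen x /\ euler x = e0 *: x) v.
  apply: eigen_in_span Lv ev => _ [z [i [u [/(proj2 (layerP z))[eu _] ->]]]].
  by exists (e0 + z%:~R + 2%:R * i%:R); apply: euler_iter_square.
(* Second projection: [v] is harmonic, so it has eigenvalue 0 under [sqlap]. *)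
have lv0 : sqlap v = 0 *: v by rewrite /sqlap /= lv linear0 scale0r.
have := eigen_in_span _ Lv1 lv0.
case=> [_ [[z [i [u [/(proj2 (layerP z)) hu ->]]]] _]|k [y [b [Bb ->]]]].
  by exists ((1 + eps) * i%:R * ((1 + eps) * (e0 + z%:~R + i%:R - 1) + eps * sdim));
     apply: square_laplace_iter.
apply: subspace_sum => [|j]; first by case: stW.
have [[W0 WD WZ] _] := stW; apply: WZ; have {Bb} Bbj := Bb j.
move: (b j) Bbj => {b y j k Lv Lv1 lv0} _ [[[z [i [u [lu ->]]]] e1] e2].
have hu := proj2 (layerP z) _ lu.
have [->|b_n0] := eqVneq (iter i square u) 0; first exact: W0.
have inj0 k x : k *: iter i square u = x *: iter i square u -> k = x.
  move/eqP; rewrite -subr_eq0 -scalerBl scaler_eq0 (negPf b_n0) orbF.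
  by rewrite subr_eq0 => /eqP.
(* For [i > 0] and [eps = 1] the eigenvalue is a nonzero multiple of [sdim + 2 (e0 + z + i - 1)],
   hence not 0; for [eps = -1] the operator [square] is zero. *)
have i0 : i = 0%N.
  case: i b_n0 inj0 e2 {e1} => // i b_n0 inj0 e2.
  have [eps1|epsN] := osc_eps osc; last first.
    by move: b_n0; rewrite /= (square_eps _ epsN n2) eqxx.
  move: e2; rewrite /= [_ (laplace _)](square_laplace_iter i.+1 hu) => /inj0 /eqP.
  rewrite eps1 !mulf_eq0 (negPf n2) /= (_ : i.+1%:R == 0 = false) /=; last first.
    by have /pcharf0P-> := F0.
  move/eqP=> e3; case/negP: (odd_degree (z + i)); apply/eqP.
  by rewrite -[RHS]e3 intrD -natr1; ring.
(* With [i = 0] the degree [e0 + z] equals [e0], hence [z = 0] in characteristic 0. *)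
move: e1 b_n0 inj0 lu; rewrite i0 (euler_iter_square 0 (proj1 hu)) /=.
move=> e1 _ /(_ _ _ e1); rewrite mulr0 addr0 => e3; have : z%:~R == 0 :> F.
  by rewrite -(inj_eq (addrI e0)) addr0 e3.
by rewrite (pchar0_intr_eq0 _ F0) => /eqP ->.
Qed.

End Layers.

End OscillatorAlgebra.

(** * Super polynomials as twisted Fock spaces *)

Section Fock.
Variables (F : fieldType) (M N : nat).
Local Notation A := (superpoly F M N).
Implicit Types (f : A) (i j : 'I_M) (p q : 'I_N) (S : {set 'I_N}).

Fact xmul_is_linear i : linear (@xmul F M N i).
Proof.
by move=> k u v; apply/ffunP=> S; rewrite !ffunE mulrDr -scalerAr.
Qed.
HB.instance Definition _ i :=
  GRing.isLinear.Build F A A *:%R (@xmul F M N i) (xmul_is_linear i).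

Fact dx_is_linear i : linear (@dx F M N i).
Proof. by move=> k u v; apply/ffunP=> S; rewrite !ffunE linearP. Qed.
HB.instance Definition _ i :=
  GRing.isLinear.Build F A A *:%R (@dx F M N i) (dx_is_linear i).

Fact thmul_is_linear p : linear (@thmul F M N p).
Proof.
move=> k u v; apply/ffunP=> S; rewrite !ffunE; case: ifP => _.
  by linear_comb F.
by rewrite scaler0 addr0.
Qed.
HB.instance Definition _ p :=
  GRing.isLinear.Build F A A *:%R (@thmul F M N p) (thmul_is_linear p).

Fact dth_is_linear p : linear (@dth F M N p).
Proof.
move=> k u v; apply/ffunP=> S; rewrite !ffunE; case: ifP => _.
  by rewrite scaler0 addr0.
by linear_comb F.
Qed.
HB.instance Definition _ p :=
  GRing.isLinear.Build F A A *:%R (@dth F M N p) (dth_is_linear p).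

Lemma xmulC i j f : xmul i (xmul j f) = xmul j (xmul i f).
Proof. by apply/ffunP=> S; rewrite !ffunE mulrCA. Qed.

Lemma dxC i j f : dx i (dx j f) = dx j (dx i f).
Proof. by apply/ffunP=> S; rewrite !ffunE mderiv_comm. Qed.

Lemma dx_xmul i j f : dx i (xmul j f) = (i == j)%:R *: f + xmul j (dx i f).
Proof.
apply/ffunP=> S; rewrite !ffunE mderivM mderivX mnm1E [j == i]eq_sym.
have [->|] := eqVneq i j; last by rewrite !scale0r mul0r.
rewrite !scale1r (_ : _ - _ = 0)%MM ?mpolyX0 ?mul1r //.
by apply/mnmP=> k; rewrite mnmBE mnm0E subnn.
Qed.

Lemma xmul_thmul i p f : xmul i (thmul p f) = thmul p (xmul i f).
Proof.
by apply/ffunP=> S; rewrite !ffunE; case: ifP; rewrite ?mulr0 // -scalerAr.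
Qed.

Lemma xmul_dth i p f : xmul i (dth p f) = dth p (xmul i f).
Proof.
by apply/ffunP=> S; rewrite !ffunE; case: ifP; rewrite ?mulr0 // -scalerAr.
Qed.

Lemma dx_thmul i p f : dx i (thmul p f) = thmul p (dx i f).
Proof.
by apply/ffunP=> S; rewrite !ffunE; case: ifP; rewrite ?mderiv0 // mderivZ.
Qed.

Lemma dx_dth i p f : dx i (dth p f) = dth p (dx i f).
Proof.
by apply/ffunP=> S; rewrite !ffunE; case: ifP; rewrite ?mderiv0 // mderivZ.
Qed.

Lemma thsignU1 p q S : q != p -> q \notin S ->
  thsign F p S = (if (q < p)%N then -1 else 1) * thsign F p (q |: S).
Proof.
by move=> nqp nqS; rewrite -{1}(setU1K nqS) thsignD1 // !inE eqxx.
Qed.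

Lemma dthC p q f : dth p (dth q f) = - dth q (dth p f).
Proof.
apply/ffunP=> S; rewrite !ffunE.
have [->|npq] := eqVneq p q.
  by rewrite !inE eqxx scaler0; case: ifP; rewrite oppr0.
rewrite !inE (eq_sym q p) (negPf npq) /=.
case: (boolP (p \in S)) => pS; case: (boolP (q \in S)) => qS;
  rewrite ?scaler0 ?oppr0 //.
rewrite setUCA !scalerA -scaleNr; congr (_ *: _).
rewrite (thsignU1 _ qS) 1?eq_sym // (thsignU1 npq pS).
by case: (ltngtP p q) npq => [||/val_inj->]; rewrite ?eqxx //= => _ _; ring.
Qed.

Definition sconst_at S (g : {mpoly F[M]}) : A :=
  [ffun S' => if S' == S then g else 0].

(** The coefficient is the sign of sorting [s]; only its being nonzero matters, so it is not
    computed. *)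
Lemma foldr_thmul (g : {mpoly F[M]}) (s : seq 'I_N) : uniq s ->
  exists2 k : F, k != 0 &
    foldr (@thmul F M N) (spconst N g) s = k *: sconst_at [set:: s] g.
Proof.
elim: s => [|p s IHs] /=.
  by exists 1; rewrite ?oner_eq0 // scale1r set_nil.
case/andP=> nps /IHs[k k_n0 ->].
exists (k * thsign F p (p |: [set:: s])).
  by rewrite mulf_neq0 // signr_eq0.
have nps' : p \notin [set:: s] by rewrite inE.
rewrite set_cons linearZ /= -scalerA; congr (_ *: _); apply/ffunP=> S.
rewrite !ffunE; case: ifP => pS; last first.
  rewrite ifN ?scaler0 //; apply: contraFneq pS => ->.
  by rewrite !inE eqxx.
have -> : (S :\ p == [set:: s]) = (S == p |: [set:: s]).
  by apply/eqP/eqP => [<-|->]; rewrite ?setD1K ?setU1K.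
by case: eqP => [->|]; rewrite ?scaler0.
Qed.

(** The theta factors are taken distinct, which later bounds their number by [N]. *)
Lemma superpoly_span f :
  in_span (fun v => exists alpha s, uniq s /\ v = spmonomial F alpha s) f.
Proof.
have -> : f = \sum_S \sum_(al <- msupp (f S)) (f S)@_al *: sconst_at S 'X_[al].
  apply/ffunP=> S; rewrite sum_ffunE (bigD1 S) //= sum_ffunE [X in _ + X]big1 ?addr0.
    rewrite [LHS]mpolyE; apply: eq_bigr => al _.
    by rewrite !ffunE eqxx.
  move=> S' nS; rewrite sum_ffunE big1 // => al _.
  by rewrite !ffunE eq_sym (negPf nS) scaler0.
set B := fun v => _; have sB := in_span_subspace B; have [_ _ BZ] := sB.
apply: subspace_sum => // S; apply: subspace_sum => // al; apply: (BZ).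
have [k k_n0 eq_k] := foldr_thmul 'X_[al] (enum_uniq (mem S)).
apply: (subspaceZ_inv sB k_n0).
have <- : [set:: enum S] = S by apply/setP=> p; rewrite inE mem_enum.
by rewrite -eq_k; apply: in_span_mem; exists al, (enum S); rewrite enum_uniq.
Qed.

Hypothesis F0 : [pchar F] =i pred0.

Lemma spconst_mulX i (g : {mpoly F[M]}) :
  spconst N ('X_i * g) = xmul i (spconst N g).
Proof.
by apply/ffunP=> S; rewrite !ffunE; case: ifP; rewrite ?mulr0.
Qed.

Lemma spconst_deriv i (g : {mpoly F[M]}) :
  spconst N (g^`M(i)) = dx i (spconst N g).
Proof. by apply/ffunP=> S; rewrite !ffunE; case: ifP; rewrite ?mderiv0. Qed.

Lemma spconstZ k (g : {mpoly F[M]}) : spconst N (k *: g) = k *: spconst N g.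
Proof. by apply/ffunP=> S; rewrite !ffunE; case: ifP; rewrite ?scaler0. Qed.

(** * Irreducibility of the Fock space under multiplications and derivations *)

Section Submodule.

Variable Z : A -> Prop.
Hypotheses (sZ : subspace Z)
  (Zx : forall i v, Z v -> Z (xmul i v)) (Zdx : forall i v, Z v -> Z (dx i v))
  (Zth : forall p v, Z v -> Z (thmul p v)) (Zdth : forall p v, Z v -> Z (dth p v)).

(** The derivation by a theta that occurs in [f] lowers the bound on the number of theta factors and
    does not give zero; repeating this leaves a polynomial in the [x_i]. *)
Lemma Fock_spconst f : Z f -> f != 0 ->
  exists2 g : {mpoly F[M]}, g != 0 & Z (spconst N g).
Proof.
have: forall S, f S != 0 -> (#|S| < N.+1)%N.
  by move=> S _; rewrite ltnS (leq_trans (max_card _)) ?card_ord.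
(* The bound is strict, so that at 0 it forces [f = 0]. *)
elim: {1}N.+1 f => [|k IHk] f suppf Zf f_n0.
  case/eqP: f_n0; apply/ffunP=> S; rewrite ffunE.
  by apply/eqP; apply: contraFT (ltn0 #|S|) => /suppf.
have [|] := boolP [exists S, (f S != 0) && (S != set0)].
  case/existsP=> S /andP[fS /set0Pn[p pS]].
  apply: (IHk (dth p f)); last 2 first.
  - exact: Zdth.
  - apply: contraNneq fS => /ffunP/(_ (S :\ p)); rewrite !ffunE !inE eqxx /=.
    rewrite setD1K // => /eqP; rewrite scaler_eq0 signr_eq0 /= => fS0.
    exact: fS0.
  move=> S'; rewrite ffunE; case: ifP => [_|pS']; first by rewrite eqxx.
  rewrite scaler_eq0 signr_eq0 /= => /suppf.
  by rewrite cardsU1 pS' add1n ltnS.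
move/existsPn => f0.
have def_f : f = spconst N (f set0).
  apply/ffunP=> S; rewrite ffunE; case: eqP => [->//|/eqP nS].
  by have := f0 S; rewrite nS andbT negbK => /eqP.
exists (f set0); last by rewrite -def_f.
apply: contraNneq f_n0 => f00; apply/eqP/ffunP => S.
by rewrite def_f f00 !ffunE if_same.
Qed.

(** Derivatives lower [msize] until a nonzero constant is left; in characteristic 0 the derivative
    by a variable that occurs is nonzero. *)
Lemma Fock_one (g : {mpoly F[M]}) : g != 0 -> Z (spconst N g) -> Z (spconst N 1).
Proof.
have [Z0 ZD ZZ] := sZ.
elim: {g}(msize g) {-2}g (leqnn (msize g)) => [|k IHk] g.
  by rewrite leqn0 msize_poly_eq0 => ->.
move=> le_g g_n0 Zg.
have [|] := boolP (has (fun al : 'X_{1..M} => [exists i, al i != 0%N]) (msupp g)).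
  case/hasP=> al; rewrite mcoeff_msupp => gal /existsP[i ali].
  apply: (IHk g^`M(i)); last 2 first.
  - apply: contraNneq gal => /(congr1 (mcoeff (al - U_(i))%MM)).
    rewrite mcoeff_mderiv mcoeff0 submK; last by rewrite lep1mP.
    rewrite -mulr_natr => /eqP; rewrite mulf_eq0.
    by have /pcharf0P-> := F0; rewrite orbF.
  - by rewrite spconst_deriv; apply: Zdx.
  rewrite msizeE; apply/bigmax_leqP_seq => m m_in _.
  have gm : (m + U_(i))%MM \in msupp g.
    move: m_in; rewrite !mcoeff_msupp mcoeff_mderiv.
    by apply: contraNneq => ->; rewrite mul0rn.
  by have := leq_trans (msize_mdeg_lt gm) le_g; rewrite mdegD mdeg1 addn1.
move/hasPn => g0; have def_g : g = (g@_0)%:MP.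
  apply/mpolyP => m; rewrite mcoeffC; have [->|m_n0] := eqVneq m 0%MM.
    by rewrite mulr1.
  rewrite mulr0; apply: memN_msupp_eq0; apply/negP => /g0 /existsPn m0.
  case/eqP: m_n0; apply/mnmP=> i; rewrite mnm0E; apply/eqP.
  by rewrite -[_ == _]negbK.
apply: (subspaceZ_inv sZ (k := g@_0)).
  by apply: contraNneq g_n0 => g00; rewrite def_g g00.
by rewrite -spconstZ -mul_mpolyC mulr1 -def_g.
Qed.

Lemma Fock_all : Z (spconst N 1) -> forall v, Z v.
Proof.
move=> Z1 v; apply: (in_span_sub sZ) (superpoly_span v) => _ [al [s [_ ->]]].
elim: s => [|p s IHs] /=; last exact: Zth.
rewrite mpolyXE_id; elim/big_rec: _ => // i g _ Zg.
elim: (al i) => [|k IHk]; first by rewrite expr0 mul1r.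
by rewrite exprS -mulrA spconst_mulX; apply: Zx.
Qed.

Lemma Fock_irreducible : (exists2 v, Z v & v != 0) -> forall v, Z v.
Proof.
case=> f Zf f_n0; have [g g_n0 Zg] := Fock_spconst Zf f_n0.
exact: Fock_all (Fock_one g_n0 Zg).
Qed.

End Submodule.

(** * Fock spaces twisted at the variables of [T] *)

Section Twisted.

Variable T : {set 'I_M}.
Local Notation idx := ('I_M + 'I_N)%type.
Implicit Types (x y : idx).

Definition fermionic x : bool := if x is inr _ then true else false.

Definition oppxmul i f : A := - xmul i f.
Fact oppxmul_is_linear i : linear (oppxmul i).
Proof. by move=> k u v; rewrite /oppxmul !linearP /= scalerN. Qed.
HB.instance Definition _ i :=
  GRing.isLinear.Build F A A *:%R (oppxmul i) (oppxmul_is_linear i).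

(** Twisting at [i \in T] replaces the pair [x_i], [d/dx_i] by [d/dx_i], [- x_i]; the sign preserves
    the commutation relation. *)
Definition raiser x : {linear A -> A} :=
  match x with
  | inl i => if i \in T then (@dx F M N i : {linear A -> A}) else @xmul F M N i
  | inr p => @thmul F M N p
  end.

Definition lowerer x : {linear A -> A} :=
  match x with
  | inl i => if i \in T then (oppxmul i : {linear A -> A}) else @dx F M N i
  | inr p => @dth F M N p
  end.

Local Notation sgn x y := (ssign F fermionic x y).

Lemma mem_neq i j : i \in T -> j \notin T -> (i == j) = false.
Proof. by move=> iT; apply: contraNF => /eqP <-. Qed.

Lemma raiserC x y f : raiser x (raiser y f) = sgn x y *: raiser y (raiser x f).
Proof.
case: x y => [i|p] [j|q] /=; rewrite /ssign /= ?scale1r ?scaleN1r.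
- case: (boolP (i \in T)) => iT; case: (boolP (j \in T)) => jT /=.
  + exact: dxC.
  + by rewrite dx_xmul mem_neq // scale0r add0r.
  + by rewrite dx_xmul mem_neq // scale0r add0r.
  + exact: xmulC.
- by case: ifP => _ /=; rewrite ?dx_thmul ?xmul_thmul.
- by case: ifP => _ /=; rewrite ?dx_thmul ?xmul_thmul.
- exact: thmulC.
Qed.

Lemma lowererC x y f :
  lowerer x (lowerer y f) = sgn x y *: lowerer y (lowerer x f).
Proof.
case: x y => [i|p] [j|q] /=; rewrite /ssign /= ?scale1r ?scaleN1r.
- case: (boolP (i \in T)) => iT; case: (boolP (j \in T)) => jT /=.
  + by rewrite /oppxmul !linearN /= xmulC.
  + by rewrite /oppxmul linearN /= dx_xmul eq_sym mem_neq // scale0r add0r.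
  + by rewrite /oppxmul linearN /= dx_xmul eq_sym mem_neq // scale0r add0r.
  + exact: dxC.
- by case: ifP => _ /=; rewrite ?dx_dth // /oppxmul linearN /= xmul_dth.
- by case: ifP => _ /=; rewrite ?dx_dth // /oppxmul linearN /= xmul_dth.
- exact: dthC.
Qed.

Lemma lowerer_raiser x y f : lowerer x (raiser y f) =
  (x == y)%:R *: f + sgn x y *: raiser y (lowerer x f).
Proof.
case: x y => [i|p] [j|q] /=; rewrite /ssign /= ?scale1r ?scaleN1r ?scale0r ?add0r.
- rewrite (_ : (inl i == inl j) = (i == j)) //.
  case: (boolP (i \in T)) => iT; case: (boolP (j \in T)) => jT /=.
  + by rewrite /oppxmul linearN /= dx_xmul eq_sym; linear_comb F.
  + by rewrite /oppxmul linearN /= xmulC mem_neq // scale0r add0r.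
  + by rewrite dxC eq_sym mem_neq // scale0r add0r.
  + exact: dx_xmul.
- by case: ifP => _ /=; rewrite ?dx_thmul // /oppxmul linearN /= xmul_thmul.
- by case: ifP => _ /=; rewrite ?dx_dth ?xmul_dth.
- by rewrite dth_thmul.
Qed.

Definition number_op f : A := \sum_x raiser x (lowerer x f).

Fact number_op_is_linear : linear number_op.
Proof.
move=> k u v; rewrite /number_op scaler_sumr -big_split; apply: eq_bigr => x _ /=.
by rewrite !linearP.
Qed.
HB.instance Definition _ :=
  GRing.isLinear.Build F A A *:%R number_op number_op_is_linear.

Lemma number_op_thmul p f :
  number_op (thmul p f) = thmul p (number_op f) + thmul p f.
Proof.
have -> : number_op (thmul p f) = \sum_x (x == inr p)%:R *: raiser x f
    + \sum_x thmul p (raiser x (lowerer x f)).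
  rewrite -big_split; apply: eq_bigr => x _ /=.
  rewrite -[thmul p f]/(raiser (inr p) f) lowerer_raiser !linearD !linearZ /=.
  rewrite -[thmul p (lowerer x f)]/(raiser (inr p) (lowerer x f)) raiserC.
  by linear_comb F; ring: (ssign2 F fermionic x (inr p)).
rewrite (bigD1 (inr p)) //= eqxx scale1r big1 => [|x /negPf->].
  by rewrite addr0 addrC linear_sum.
by rewrite scale0r.
Qed.

(** A twisted variable contributes [d/dx_i (- x_i) = - x_i d/dx_i - 1], whence its negative degree
    and the constant [- #|T|]. *)
Lemma number_op_spconst (al : 'X_{1..M}) :
  number_op (spconst N 'X_[al]) =
  (\sum_(i in ~: T) (al i)%:R - \sum_(i in T) (al i)%:R - #|T|%:R)
    *: spconst N 'X_[al].
Proof.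
have -> : number_op (spconst N 'X_[al]) =
    \sum_i (if i \in T then - (al i)%:R - 1 else (al i)%:R) *: spconst N 'X_[al].
  rewrite /number_op big_sumType /= [X in _ + X]big1 ?addr0; last first.
    by move=> p _; rewrite dth_const linear0.
  have xdx i :
      xmul i (dx i (@spconst F M N 'X_[al])) = (al i)%:R *: spconst N 'X_[al].
    rewrite -spconst_deriv -spconst_mulX mderivX -scalerAr spconstZ -mpolyXD.
    case: (posnP (al i)) => [->|al_i]; first by rewrite !scale0r.
    by rewrite addmC submK // lep1mP -lt0n.
  apply: eq_bigr => i _; case: (boolP (i \in T)) => iT /=; last exact: xdx.
  by rewrite /oppxmul linearN /= dx_xmul eqxx xdx; linear_comb F.
rewrite -scaler_suml (bigID (mem T)) /=; congr (_ *: _).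
rewrite (eq_bigr (fun i => - (al i)%:R - 1)) => [|i -> //].
rewrite [X in _ + X](eq_bigr (fun i => (al i)%:R)) => [|i /negPf-> //].
rewrite sumrB sumrN sumr_const addrC addrA; congr (_ - _ - _).
by apply: eq_bigl => i; rewrite inE.
Qed.

Lemma number_op_spmonomial (al : 'X_{1..M}) (s : seq 'I_N) :
  number_op (spmonomial F al s) =
  (((size s)%:Z - \sum_(i in T) (al i)%:Z + \sum_(i in ~: T) (al i)%:Z)%:~R
    - #|T|%:R) *: spmonomial F al s.
Proof.
elim: s => [|p s IHs] /=.
  rewrite number_op_spconst sub0r intrD mulrNz !rmorph_sum /=.
  by congr (_ *: _); ring.
rewrite number_op_thmul IHs linearZ /= intS !intrD.
by linear_comb F.
Qed.

(** In characteristic 0 the eigenvalue of [number_op] determines the degree; for the converse,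
    [eigen_in_span] picks the monomials of that eigenvalue out of an expansion. *)
Lemma component_number_op (k : int) f :
  component T k f <-> number_op f = (k%:~R - #|T|%:R) *: f.
Proof.
split.
  apply: (in_span_sub (W := fun g => number_op g = _ *: g)); last first.
    by move=> _ [al [s [_ <- ->]]]; rewrite number_op_spmonomial.
  split=> [|u v Nu Nv|x v Nv]; first by rewrite linear0 scaler0.
    by rewrite linearD /= Nu Nv scalerDr.
  by rewrite linearZ /= Nv !scalerA mulrC.
have sC : subspace (component T k : A -> Prop) := in_span_subspace _.
move=> Nf; have eig (b : A) :
    (exists al s, uniq s /\ b = spmonomial F al s) ->
    exists z : F, number_op b = z *: b.
  by case=> al [s [_ ->]]; eexists; apply: number_op_spmonomial.
apply: (in_span_sub sC _ (eigen_in_span eig (superpoly_span f) Nf)).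
  move=> _ [[al [s [uniq_s ->]]]]; rewrite /= number_op_spmonomial => /eqP.
  rewrite -subr_eq0 -scalerBl scaler_eq0 => /orP[|/eqP->]; last by case: sC.
  rewrite opprB addrA subrK subr_eq0 => /eqP eq_k.
  apply: in_span_mem; exists al, s; split=> //.
    by have := max_card (mem s); rewrite card_ord (card_uniqP uniq_s).
  apply/eqP; rewrite -subr_eq0 -(pchar0_intr_eq0 _ F0) intrB subr_eq0.
  exact/eqP.
Qed.

Lemma twisted_irreducible (Z : A -> Prop) : subspace Z ->
  (forall x v, Z v -> Z (raiser x v)) -> (forall x v, Z v -> Z (lowerer x v)) ->
  (exists2 v, Z v & v != 0) -> forall v, Z v.
Proof.
move=> sZ Zr Zl; have [_ _ ZZ] := sZ; apply: Fock_irreducible => //.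
- move=> i v Zv; case: (boolP (i \in T)) => iT.
    have := ZZ (-1) _ (Zl (inl i) v Zv); rewrite /= iT /= /oppxmul.
    by rewrite scaleN1r opprK.
  by have := Zr (inl i) v Zv; rewrite /= (negPf iT).
- move=> i v Zv; case: (boolP (i \in T)) => iT.
    by have := Zr (inl i) v Zv; rewrite /= iT.
  by have := Zl (inl i) v Zv; rewrite /= (negPf iT).
- by move=> p v; apply: (Zr (inr p)).
- by move=> p v; apply: (Zl (inr p)).
Qed.

End Twisted.

End Fock.

(** * The matrices of osp and their action *)

Lemma split_lshift (a b : nat) (i : 'I_a) : split (lshift b i) = inl i.
Proof. exact: (unsplitK (inl i)). Qed.

Lemma split_rshift (a b : nat) (i : 'I_b) : split (rshift a i) = inr i.
Proof. exact: (unsplitK (inr i)). Qed.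

Section OspMatrices.

Variables (F : fieldType) (m1 n : nat).
Local Notation m := (m1 + m1 + 1)%N.
Local Notation d := 'I_(m + (n + n)).

Definition ia (k : 'I_m1) : d := lshift (n + n) (xa k).
Definition ib (k : 'I_m1) : d := lshift (n + n) (xb k).
Definition ic : d := lshift (n + n) (xc m1).
Definition ip (k : 'I_n) : d := rshift m (lshift n k).
Definition iq (k : 'I_n) : d := rshift m (rshift n k).

Lemma osp_index_ind (P : d -> Prop) :
  (forall k, P (ia k)) -> (forall k, P (ib k)) -> P ic ->
  (forall k, P (ip k)) -> (forall k, P (iq k)) -> forall I, P I.
Proof.
move=> Pa Pb Pc Pp Pq I.
case: (split_ordP I) => [i|p] ->; last first.
  by case: (split_ordP p) => k ->; [apply: Pp | apply: Pq].
case: (split_ordP i) => [j|z] ->; last by rewrite [z]ord1; apply: Pc.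
by case: (split_ordP j) => k ->; [apply: Pa | apply: Pb].
Qed.

Lemma sum_osp_index (V : nmodType) (f : d -> V) :
  \sum_I f I = \sum_k f (ia k) + \sum_k f (ib k) + f ic
    + (\sum_k f (ip k) + \sum_k f (iq k)).
Proof. by rewrite !big_split_ord big_ord1. Qed.

(** Data given block by block: with [osp_caseE], identities about the form are checked on the five
    kinds of index. *)
Definition osp_case (T : Type) (fa fb : 'I_m1 -> T) (fc : T) (fp fq : 'I_n -> T)
    (I : d) : T :=
  match split I with
  | inl i => match split i with
             | inl j => match split j with inl k => fa k | inr k => fb k end
             | inr _ => fc
             end
  | inr p => match split p with inl k => fp k | inr k => fq k end
  end.

Lemma osp_caseE T fa fb fc fp fq :
  (forall k, @osp_case T fa fb fc fp fq (ia k) = fa k)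
  * (forall k, @osp_case T fa fb fc fp fq (ib k) = fb k)
  * (@osp_case T fa fb fc fp fq ic = fc)
  * (forall k, @osp_case T fa fb fc fp fq (ip k) = fp k)
  * (forall k, @osp_case T fa fb fc fp fq (iq k) = fq k).
Proof.
rewrite /osp_case /ia /ib /ic /ip /iq /xa /xb /xc.
by do 4?split; move=> *; rewrite !(split_lshift, split_rshift).
Qed.

(** Duality for the form that defines osp; [osp_sign] carries the sign of its alternating block. *)
Definition osp_inv : d -> d := osp_case ib ia ic iq ip.
Definition symplectic : d -> bool :=
  osp_case (fun=> false) (fun=> false) false (fun=> true) (fun=> true).
Definition osp_sign : d -> F :=
  osp_case (fun=> 1) (fun=> 1) 1 (fun=> 1) (fun=> -1).
(* [osp] is spanned by the [E_(I,J) - tau_(I,J) E_(J',I')]. *)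
Definition osp_tau (I J : d) : F :=
  osp_sign I * osp_sign J * (if symplectic I && ~~ symplectic J then -1 else 1).

Definition osp_idxE := (osp_caseE ib ia ic iq ip,
  osp_caseE (fun=> false) (fun=> false) false (fun=> true) (fun=> true),
  osp_caseE (fun=> 1 : F) (fun=> 1) 1 (fun=> 1) (fun=> -1)).

Lemma osp_invK : involutive osp_inv.
Proof. by elim/osp_index_ind => *; rewrite /osp_inv !osp_idxE. Qed.

Lemma symplectic_inv I : symplectic (osp_inv I) = symplectic I.
Proof.
by elim/osp_index_ind: I => *; rewrite /symplectic /osp_inv !osp_idxE.
Qed.

Lemma osp_sign_inv I :
  osp_sign (osp_inv I) = (if symplectic I then -1 else 1) * osp_sign I.
Proof.
by elim/osp_index_ind: I => *;
   rewrite /osp_sign /symplectic /osp_inv !osp_idxE; ring.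
Qed.

Lemma osp_sign2 I : osp_sign I * osp_sign I = 1.
Proof. by elim/osp_index_ind: I => *; rewrite /osp_sign !osp_idxE; ring. Qed.

Definition osp_relation (X : 'M[F]_(m + (n + n))) : Prop :=
  forall I J, X (osp_inv J) (osp_inv I) = - osp_tau I J * X I J.

(** The block shape says, entry by entry, that transposing along the duality multiplies by
    [- osp_tau]; the 25 pairs of index kinds are checked separately. *)
Lemma osp_relationP X : 2%:R != 0 :> F -> osp X <-> osp_relation X.
Proof.
move=> n2; split.
  case=> A [B [C [D [E [G [H [H1 [K [K1 [U [V [M [M1 [sB sC sE sG ->]]]]]]]]]]]]]].
  move/matrixP: sB => sB; move/matrixP: sC => sC.
  move/matrixP: sE => sE; move/matrixP: sG => sG.
  (* The pairs left by [ring] are those inside [B], [C], [E] and [G], which need the symmetries of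
     these blocks. *)
  elim/osp_index_ind => [k|k||k|k]; elim/osp_index_ind => [l|l||l|l];
    rewrite /osp_tau /osp_inv /osp_sign /symplectic !osp_idxE;
    rewrite /ia /ib /ic /ip /iq /xa /xb /xc;
    rewrite !(block_mxEul, block_mxEur, block_mxEdl, block_mxEdr, row_mxEl,
              row_mxEr, col_mxEu, col_mxEd, mxE) /=; try ring.
  - by have := sB l k; rewrite !mxE => ->; ring.
  - by have := sC l k; rewrite !mxE => ->; ring.
  - by have := sE l k; rewrite !mxE => ->; ring.
  - by have := sG l k; rewrite !mxE => ->; ring.
move=> relX.
exists (\matrix_(k, l) X (ia k) (ia l)), (\matrix_(k, l) X (ia k) (ib l)),
  (\matrix_(k, l) X (ib k) (ia l)), (\matrix_(k, l) X (ip k) (ip l)),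
  (\matrix_(k, l) X (ip k) (iq l)), (\matrix_(k, l) X (iq k) (ip l)),
  (\matrix_(k, l) X (ia k) (ip l)), (\matrix_(k, l) X (ia k) (iq l)),
  (\matrix_(k, l) X (ib k) (ip l)), (\matrix_(k, l) X (ib k) (iq l)),
  (\col_k X (ia k) ic), (\col_k X (ib k) ic), (\row_l X ic (ip l)),
  (\row_l X ic (iq l)).
(* The index [ic] is its own dual, so the relation makes this entry its own opposite. *)
have Xcc : X ic ic = 0.
  have := relX ic ic; rewrite /osp_tau /osp_inv /osp_sign /symplectic !osp_idxE /=.
  rewrite !mulr1 mulN1r => Xcc; have : 2%:R * X ic ic == 0.
    by rewrite mulr_natl mulr2n {2}Xcc subrr.
  by rewrite mulf_eq0 (negPf n2) => /eqP.
have tr I J := relX I J; rewrite /osp_tau /osp_inv /osp_sign /symplectic in tr.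
split; last apply/matrixP.
1-4: apply/matrixP => k l; rewrite !mxE.
- by have := tr (ia l) (ib k); rewrite !osp_idxE /= => ->; ring.
- by have := tr (ib l) (ia k); rewrite !osp_idxE /= => ->; ring.
- by have := tr (ip l) (iq k); rewrite !osp_idxE /= => ->; ring.
- by have := tr (iq l) (ip k); rewrite !osp_idxE /= => ->; ring.
elim/osp_index_ind => [k|k||k|k]; elim/osp_index_ind => [l|l||l|l];
  rewrite /ia /ib /ic /ip /iq /xa /xb /xc;
  rewrite !(block_mxEul, block_mxEur, block_mxEdl, block_mxEdr, row_mxEl,
            row_mxEr, col_mxEu, col_mxEd, mxE) ?ord1 //.
- by have := tr (ia l) (ia k); rewrite !osp_idxE /= => ->; ring.
- by have := tr (ib l) (ic); rewrite !osp_idxE /= => ->; ring.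
- by have := tr (ia l) (ic); rewrite !osp_idxE /= => ->; ring.
- by have := tr (ib l) (iq k); rewrite !osp_idxE /= => ->; ring.
- by have := tr (ia l) (iq k); rewrite !osp_idxE /= => ->; ring.
- by have := tr (ic) (iq k); rewrite !osp_idxE /= => ->; ring.
- by have := tr (ib l) (ip k); rewrite !osp_idxE /= => ->; ring.
- by have := tr (ia l) (ip k); rewrite !osp_idxE /= => ->; ring.
- by have := tr (ic) (ip k); rewrite !osp_idxE /= => ->; ring.
- by have := tr (ip l) (ip k); rewrite !osp_idxE /= => ->; ring.
Qed.

End OspMatrices.

(** * The Fock space as an oscillator algebra for the form of osp *)

Section OspOscillator.

Variables (F : fieldType) (m1 n M N : nat).
Local Notation m := (m1 + m1 + 1)%N.
Local Notation d := 'I_(m + (n + n)).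
Local Notation A := (superpoly F M N).

Variables (T : {set 'I_M}) (flip : bool) (slot : d -> 'I_M + 'I_N).
Hypothesis F0 : [pchar F] =i pred0.
Hypothesis slot_bij : bijective slot.
(* [flip] holds in the first family, where the symplectic indices are fermionic. *)
Hypothesis slot_par : forall I, fermionic (slot I) = (symplectic I == flip).

Let n2 : 2%:R != 0 :> F.
Proof. by have /pcharf0P-> := F0. Qed.

Let par (I : d) : bool := fermionic (slot I).
Definition osp_eps : F := if flip then 1 else -1.
Local Notation eps := osp_eps.
Let eps2 : eps * eps = 1.
Proof. by rewrite /osp_eps; case: flip; ring. Qed.
(** The sign [- eps] on symplectic indices is the one for which [tau_kap] also holds when exactly
    one of the two indices is symplectic. *)
Definition osp_metric (I : d) : F :=
  if symplectic I then - eps * osp_sign F I else 1.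
Local Notation kap := osp_metric.
Local Notation inv := (@osp_inv m1 n).

Definition slot_raise (I : d) : {linear A -> A} := @raiser F M N T (slot I).
Definition slot_lower (I : d) : {linear A -> A} :=
  kap I \*: @lowerer F M N T (slot (inv I)).

Lemma slot_lowerE I v : slot_lower I v = kap I *: @lowerer F M N T (slot (inv I)) v.
Proof. by []. Qed.

Lemma kap2 I : kap I * kap I = 1.
Proof.
rewrite /osp_metric /osp_eps; case: ifP => _; last by rewrite mulr1.
by case: (flip); ring: (osp_sign2 F I).
Qed.

Lemma ssign_diag I : ssign F par I I = if par I then -1 else 1.
Proof. by rewrite /ssign andbb; case: (par I). Qed.

Lemma slot_oscillator : oscillator par inv kap eps slot_raise slot_lower.
Proof.
have parV I : par (inv I) = par I by rewrite /par !slot_par symplectic_inv.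
split.
- by rewrite /osp_eps; case: (flip); [left | right].
- exact: osp_invK.
- exact: parV.
- exact: kap2.
- move=> I; rewrite ssign_diag /par slot_par /osp_metric symplectic_inv.
  rewrite osp_sign_inv /osp_eps.
  by case: (symplectic I); case: (flip) => /=; ring.
- by move=> I J v; apply: raiserC.
- move=> I J v; rewrite !slot_lowerE !linearZ /= lowererC.
  rewrite -[ssign _ _ _ _]/(ssign F par (inv I) (inv J)).
  rewrite /ssign !parV.
  by linear_comb F.
- move=> I J v; rewrite !slot_lowerE lowerer_raiser linearZ /= /pairing.
  rewrite (bij_eq slot_bij) -[ssign _ _ _ _]/(ssign F par (inv I) J).
  rewrite /ssign parV [inv I == J]eq_sym.
  by case: (J == inv I); linear_comb F.
Qed.

Lemma slot_euler v : euler inv kap slot_raise slot_lower v = number_op T v.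
Proof.
rewrite /number_op (reindex slot) /=; last exact: onW_bij.
rewrite /euler (reindex_inj (can_inj (@osp_invK m1 n))).
apply: eq_bigr => I _; rewrite slot_lowerE linearZ scalerA kap2 scale1r.
by rewrite /slot_raise osp_invK.
Qed.

Definition slot_E (I J : d) (v : A) : A :=
  @raiser F M N T (slot I) (@lowerer F M N T (slot J) v).

(** Lowering an index turns the sign [osp_tau] of the matrix relation into the sign in [Lop]. *)
Lemma tau_kap I J :
  osp_tau F I (inv J) * (kap I * kap J) = eps * ssign F par I J.
Proof.
rewrite /osp_tau /ssign /par !slot_par /osp_metric symplectic_inv.
rewrite osp_sign_inv /osp_eps.
have sig1 (K : d) : symplectic K = false -> osp_sign F K = 1.
  by elim/osp_index_ind: K => [k|k||k|k]; rewrite /osp_sign /symplectic !osp_idxE.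
move: (osp_sign2 F I) (osp_sign2 F J) => sI sJ.
case oI: (symplectic I); case oJ: (symplectic J).
- by case: (flip) => /=; ring: sI sJ.
- by rewrite (sig1 J oJ); case: (flip) => /=; ring: sI.
- by rewrite (sig1 I oI); case: (flip) => /=; ring: sJ.
- by rewrite (sig1 I oI) (sig1 J oJ); case: (flip) => /=; ring.
Qed.

(* In terms of [Y I J = kap J * X I J'], membership in [osp] is super
   (skew)symmetry. *)
Lemma osp_skew X : osp X -> forall I J,
  X J (inv I) * kap I = - (eps * ssign F par I J) * (X I (inv J) * kap J).
Proof.
move=> /(osp_relationP X n2) relX I J.
have := relX I (inv J); rewrite osp_invK => ->; rewrite -tau_kap.
by ring: (kap2 J).
Qed.

(** Adding the double sum to its transpose doubles it, and by [osp_skew] the two terms at [I], [J]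
    combine to a multiple of [Lop I J]. *)
Lemma act_Lop X v : osp X -> 2%:R *: mx_act slot_E X v =
  \sum_I \sum_J (X I (inv J) * kap J)
     *: Lop par eps slot_raise slot_lower I J v.
Proof.
move=> oX.
pose f I J := (X I (inv J) * kap J) *: slot_raise I (slot_lower J v).
have act_f : mx_act slot_E X v = \sum_I \sum_J f I J.
  apply: eq_bigr => I _.
  rewrite (reindex_inj (can_inj (@osp_invK m1 n))) /=; apply: eq_bigr => J _.
  rewrite /f slot_lowerE linearZ /= /slot_raise /slot_E.
  by linear_comb F; ring: (kap2 J).
have -> : 2%:R *: mx_act slot_E X v =
    \sum_I \sum_J f I J + \sum_I \sum_J f J I.
  by rewrite [X in _ + X]exchange_big /= act_f; linear_comb F.
rewrite -big_split; apply: eq_bigr => I _; rewrite -big_split; apply: eq_bigr => J _.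
by rewrite /= /f (osp_skew oX I J) Lop_split.
Qed.

(** Converse of [act_Lop]: it makes every submodule stable under all [Lop I J]. *)
Lemma Lop_act I J : exists2 X : 'M[F]_(m + (n + n)), osp X &
  forall v, mx_act slot_E X v = Lop par eps slot_raise slot_lower I J v.
Proof.
(* The matrix unit at [(I, J)], made super skew symmetric in lowered indices; [X] raises the second
   index back. *)
pose y K L : F := ((K == I) && (L == J))%:R
  - eps * ssign F par I J * ((K == J) && (L == I))%:R.
pose X : 'M[F]_(m + (n + n)) := \matrix_(K, L) (y K (inv L) * kap (inv L)).
have XE K L : X K (inv L) * kap L = y K L.
  by rewrite mxE osp_invK -mulrA kap2 mulr1.
have oX : osp X.
  apply/(osp_relationP _ n2) => K L.
  have {L}[L ->] : exists L', L = inv L'.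
    by exists (inv L); rewrite osp_invK.
  rewrite !mxE !osp_invK.
  have -> : y L K = - (eps * ssign F par K L) * y K L.
    rewrite /y; case: (boolP ((K == I) && (L == J))) => [/andP[/eqP-> /eqP->]|nA].
      rewrite !eqxx /= [(J == I) && _]andbC.
      by case: (_ && _) => /=; ring: eps2 (ssign2 F par I J).
    rewrite [(L == J) && _]andbC (negPf nA) [(L == I) && _]andbC.
    case: (boolP ((K == J) && (L == I))) => [/andP[/eqP-> /eqP->]|_] /=;
      last by ring.
    by rewrite [ssign F par J I]ssignC; ring: eps2 (ssign2 F par I J).
  rewrite -tau_kap; ring: (kap2 K) (kap2 L).
exists X => // v; apply: (scalerI n2); rewrite (act_Lop _ oX).
pose f K L := Lop par eps slot_raise slot_lower K L v.
have sum_delta K0 L0 :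
    \sum_K \sum_L ((K == K0) && (L == L0))%:R *: f K L = f K0 L0.
  rewrite (bigD1 K0) //= [X in _ + X]big1 ?addr0; last first.
    by move=> K /negPf nK; rewrite big1 // => L _; rewrite nK scale0r.
  rewrite (bigD1 L0) //= !eqxx scale1r big1 ?addr0 //.
  by move=> L /negPf nL; rewrite nL andbF scale0r.
(* By [Lop_sym] both terms equal [Lop I J], which matches the factor 2 of [act_Lop]. *)
transitivity (f I J - (eps * ssign F par I J) *: f J I).
  rewrite -(sum_delta I J) -(sum_delta J I) scaler_sumr -sumrB.
  apply: eq_bigr => K _; rewrite scaler_sumr -sumrB; apply: eq_bigr => L _.
  by rewrite XE -/(f K L) /y; move: (f K L) => u; linear_comb F.
rewrite /f [in X in _ - X](Lop_sym slot_oscillator) -/(f I J); move: (f I J) => u.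
by linear_comb F; ring: eps2 (ssign2 F par I J).
Qed.

(** * Irreducibility of the harmonic vectors of one degree *)

Section Irreducible.

Variables (k : int) (U : A -> Prop).
Hypothesis odd_degree :
  forall z : int, sdim F par + 2%:R * (k%:~R - #|T|%:R + z%:~R) != 0.
Hypothesis harmU : forall v, U v <-> component T k v /\
  laplace inv kap slot_lower v = 0.

Lemma harmonicU v :
  U v <-> harmonic inv kap slot_raise slot_lower (k%:~R - #|T|%:R) v.
Proof.
split=> [/harmU[/(component_number_op F0) Nv lv]|[ev lv]].
  by split=> //; rewrite slot_euler.
apply/harmU; split=> //; apply/(component_number_op F0).
by rewrite -slot_euler.
Qed.

Lemma slot_irreducible : irreducible (@osp F m1 n) (mx_act slot_E) U.
Proof.
have osc := slot_oscillator.
have [H0 HD HZ] := harmonic_subspace inv kap slot_raise slot_lower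
  (k%:~R - #|T|%:R).
have sU : subspace U.
  split=> [|u v /harmonicU Uu /harmonicU Uv|x v /harmonicU Uv]; apply/harmonicU.
  - exact: H0.
  - exact: HD.
  - exact: HZ.
split.
  have [U0 UD UZ] := sU; split=> [||//|X v oX Uv]; [exact: U0 | exact: UD |].
  apply: (subspaceZ_inv sU n2); rewrite (act_Lop _ oX).
  apply: (@subspace_sum F A U _ _ _ sU) => I.
  apply: (@subspace_sum F A U _ _ _ sU) => J; apply: UZ.
  by apply/harmonicU/(harmonic_Lop osc); apply/harmonicU.
move=> W [W0 WD WZ WX] WU.
(* Excluded middle: either [W] has a nonzero vector, and then contains [U], or it is zero. *)
case: (classic (exists2 w, W w & w != 0)) => [[w Ww w_n0]|W_0]; last first.
  left=> v Wv; apply/eqP; case: eqVneq => // v_n0.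
  by case: W_0; exists v.
right=> v /harmonicU hv; apply: (harmonic_sub osc F0 odd_degree _ _ _ Ww w_n0 hv).
- split=> // I J u Wu; have [X oX <-] := Lop_act I J.
  exact: WX.
- by move=> u /WU/harmonicU.
(* Every variable is the slot of an index and [kap] squares to 1, so [Z] is stable under all
   [raiser] and [lowerer]. *)
move=> Z sZ Zr Zl; apply: (twisted_irreducible F0 (T := T)) => // x u Zu.
  have [I ->] : exists I, x = slot I.
    by case: slot_bij => g _ gK; exists (g x); rewrite gK.
  exact: Zr.
have [I ->] : exists I, x = slot I.
  by case: slot_bij => g _ gK; exists (g x); rewrite gK.
have [_ _ ZZ] := sZ; have := ZZ (kap (inv I)) _ (Zl (inv I) u Zu).
by rewrite slot_lowerE osp_invK scalerA kap2 scale1r.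
Qed.

End Irreducible.
End OspOscillator.

(** The actions need only agree pointwise, so no extensionality is invoked. *)
Lemma irreducible_ext (F : fieldType) (d : nat) (V : lmodType F)
    (L : 'M[F]_d -> Prop) (act1 act2 : 'M[F]_d -> V -> V) (U : V -> Prop) :
  (forall X v, act1 X v = act2 X v) -> irreducible L act1 U -> irreducible L act2 U.
Proof.
move=> eq_act; have eq_sub W : is_submodule L act1 W <-> is_submodule L act2 W.
  split=> -[W0 WD WZ WX]; split=> // X v LX Wv.
    by rewrite -eq_act; apply: WX.
  by rewrite eq_act; apply: WX.
by case=> /eq_sub sU irrU; split=> // W /eq_sub; apply: irrU.
Qed.

(** * The two families of modules *)

Section Families.

Variables (F : fieldType) (m1 n : nat).
Hypothesis F0 : [pchar F] =i pred0.
Local Notation m := (m1 + m1 + 1)%N.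
Local Notation d := 'I_(m + (n + n)).

Lemma symplectic_lshift (i : 'I_m) : symplectic (lshift (n + n) i : d) = false.
Proof.
rewrite /symplectic /osp_case split_lshift.
by case: (split i) => // j; case: (split j).
Qed.

Lemma symplectic_rshift (p : 'I_(n + n)) : symplectic (rshift m p : d) = true.
Proof.
by rewrite /symplectic /osp_case split_rshift; case: (split p).
Qed.

Definition slot1 (I : d) : 'I_m + 'I_(n + n) := split I.
Definition slot2 (I : d) : 'I_(n + n) + 'I_m :=
  match split I with inl p => inr p | inr i => inl i end.

Lemma slot1_bij : bijective slot1.
Proof. by exists unsplit; [apply: splitK | apply: unsplitK]. Qed.

Lemma slot2_bij : bijective slot2.
Proof.
exists (fun x => match x with inl i => rshift m i | inr p => lshift (n + n) p end).
  by move=> I; rewrite /slot2; case: (split_ordP I) => i ->.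
case=> i; first by rewrite /slot2 split_rshift.
by rewrite /slot2 split_lshift.
Qed.

Lemma slot1_par I : fermionic (slot1 I) = (symplectic I == true).
Proof.
rewrite /slot1; case: (split_ordP I) => i ->.
  by rewrite symplectic_lshift.
by rewrite symplectic_rshift.
Qed.

Lemma slot2_par I : fermionic (slot2 I) = (symplectic I == false).
Proof.
rewrite /slot2; case: (split_ordP I) => i ->.
  by rewrite symplectic_lshift.
by rewrite symplectic_rshift.
Qed.

Lemma odd_intr_neq0 (z : int) : (2%:R * z + 1)%:~R != 0 :> F.
Proof. by rewrite (pchar0_intr_eq0 _ F0); lia. Qed.

Lemma slot1_sdim :
  sdim F (fun I => fermionic (slot1 I)) = m%:R - (n + n)%:R.
Proof.
rewrite /sdim big_split_ord /=.
rewrite (eq_bigr (fun=> 1)) => [|i _]; last first.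
  by rewrite /ssign slot1_par symplectic_lshift.
rewrite [X in _ + X](eq_bigr (fun=> -1)) => [|i _]; last first.
  by rewrite /ssign slot1_par symplectic_rshift.
by rewrite sumrN !sumr_const !card_ord.
Qed.

Lemma slot2_sdim :
  sdim F (fun I => fermionic (slot2 I)) = (n + n)%:R - m%:R.
Proof.
rewrite /sdim big_split_ord /=.
rewrite (eq_bigr (fun=> -1)) => [|i _]; last first.
  by rewrite /ssign slot2_par symplectic_lshift.
rewrite [X in _ + X](eq_bigr (fun=> 1)) => [|i _]; last first.
  by rewrite /ssign slot2_par symplectic_rshift.
by rewrite sumrN !sumr_const !card_ord addrC.
Qed.

Lemma osc_bbE M N (T : {set 'I_M}) i j (v : superpoly F M N) :
  osc_bb T i j v = @raiser F M N T (inl i) (@lowerer F M N T (inl j) v).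
Proof.
rewrite /osc_bb /=; case: (boolP (i \in T)) => iT; case: (boolP (j \in T)) => jT //=.
  by rewrite /oppxmul linearN /= dx_xmul; linear_comb F.
by rewrite /oppxmul linearN.
Qed.

Lemma osc_bfE M N (T : {set 'I_M}) i p (v : superpoly F M N) :
  osc_bf T i p v = @raiser F M N T (inl i) (@lowerer F M N T (inr p) v).
Proof. by rewrite /osc_bf /=; case: ifP. Qed.

Lemma osc_fbE M N (T : {set 'I_M}) p j (v : superpoly F M N) :
  osc_fb T p j v = @raiser F M N T (inr p) (@lowerer F M N T (inl j) v).
Proof. by rewrite /osc_fb /=; case: ifP; rewrite // /oppxmul linearN. Qed.

Lemma slot1_act r (X : 'M[F]_(m + (n + n))) v :
  mx_act (slot_E (lowset m1 r) slot1) X v = osp_act1 r X v.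
Proof.
apply: eq_bigr => I _; apply: eq_bigr => J _; congr (_ *: _).
rewrite /slot_E /slot1 /glE1; case: (split I) => i; case: (split J) => j.
- by rewrite osc_bbE.
- by rewrite osc_bfE.
- by rewrite osc_fbE.
- by [].
Qed.

Lemma slot2_act T (X : 'M[F]_(m + (n + n))) v :
  mx_act (slot_E T slot2) X v = osp_act2 T X v.
Proof.
apply: eq_bigr => I _; apply: eq_bigr => J _; congr (_ *: _).
rewrite /slot_E /slot2 /glE2; case: (split I) => i; case: (split J) => j.
- by [].
- by rewrite osc_fbE.
- by rewrite osc_bfE.
- by rewrite osc_bbE.
Qed.

(** A pair of distinct dual indices occurs twice in [laplace], whence the factors 2 of [Delta]. As
    [r <= m1], only the [xa i] with [i < r] are twisted; lowering there is [- x_i], whence the minus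
    sign. *)
Lemma slot1_laplace r v : (r <= m1)%N ->
  laplace (@osp_inv m1 n) (@osp_metric F m1 n true)
    (slot_lower F (lowset m1 r) true slot1) v = Delta r v.
Proof.
move=> le_r.
pose b I := lowerer F (lowset m1 r) (slot1 I).
have -> : laplace (@osp_inv m1 n) (@osp_metric F m1 n true)
    (slot_lower F (lowset m1 r) true slot1) v =
    \sum_I osp_metric F true (osp_inv I) *: b I (b (osp_inv I) v).
  apply: eq_bigr => I _; rewrite !slot_lowerE linearZ /= osp_invK !scalerA.
  by rewrite linearZ /= scalerA -mulrA kap2 mulr1.
have slotE : (forall i : 'I_m, slot1 (lshift (n + n) i) = inl i) *
    (forall p : 'I_(n + n), slot1 (rshift m p) = inr p).
  by split=> *; rewrite /slot1 (split_lshift, split_rshift).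
have b_bos i u : i \notin lowset m1 r -> b (lshift (n + n) i) u = dx i u.
  by move=> /negPf iT; rewrite /b slotE /= iT.
have b_fer p u : b (rshift m p) u = dth p u by rewrite /b slotE.
have xbT k : xb k \notin lowset m1 r.
  by rewrite inE -leqNgt (leq_trans le_r) //= leq_addr.
have xcT : xc m1 \notin lowset m1 r.
  by rewrite inE -leqNgt (leq_trans le_r) //= addn0 leq_addr.
pose S := - (\sum_(i < m1 | (i < r)%N) xmul (xa i) (dx (xb i) v))
  + \sum_(i < m1 | (r <= i)%N) dx (xa i) (dx (xb i) v).
have sum_ab : \sum_k b (ia n k) (b (ib n k) v) = S.
  rewrite (bigID (fun k : 'I_m1 => (k < r)%N)) /= /S -sumrN; congr (_ + _).
    apply: eq_bigr => k lt_k; rewrite [b (ib n k) v]b_bos //.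
    by rewrite /b slotE /= inE /= lt_k.
  apply: eq_big => [k|k]; rewrite -leqNgt // => ge_k.
  by rewrite [b (ib n k) v]b_bos // b_bos // inE -leqNgt.
pose H := \sum_(k < n) dth (lshift n k) (dth (rshift n k) v).
pose tab k := b (ia n k) (b (ib n k) v).
pose th k := dth (lshift n k) (dth (rshift n k) v).
pose tc := dx (xc m1) (dx (xc m1) v).
have termE := osp_caseE tab tab tc th th.
(* Both orders of a dual pair give the same term: the bosonic factors commute, and the sign of the
   fermionic exchange is absorbed by the form. *)
have def_term I : osp_metric F true (osp_inv I) *: b I (b (osp_inv I) v) =
    osp_case tab tab tc th th I.
  rewrite /osp_metric /osp_eps /osp_sign /symplectic /osp_inv.
  elim/osp_index_ind: I => [k|k||k|k]; rewrite termE !osp_idxE ?scale1r //.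
  - by rewrite /tab /b lowererC /ia /ib !slotE /ssign scale1r.
  - by rewrite /ic !b_bos.
  - by rewrite /th /ip /iq !b_fer mulrNN mulr1 scale1r.
  - by rewrite /th /ip /iq !b_fer mulr1 dthC scalerN scaleN1r opprK.
rewrite (eq_bigr _ (fun I _ => def_term I)) sum_osp_index termE.
rewrite !(eq_bigr _ (fun k _ => termE.1.1.1.1 k)).
rewrite !(eq_bigr _ (fun k _ => termE.1.1.1.2 k)).
rewrite !(eq_bigr _ (fun k _ => termE.1.2 k)) !(eq_bigr _ (fun k _ => termE.2 k)).
rewrite sum_ab -/H /Delta -/H /S /tc.
by linear_comb F.
Qed.

Lemma superharmonic_irreducible (r : nat) (k : int) : (r <= m1)%N ->
  osp_irreducible1 r (@superharmonic F m1 n r k).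
Proof.
move=> le_r; apply: (irreducible_ext (slot1_act r)).
apply: (slot_irreducible F0 slot1_bij slot1_par (k := k)).
  move=> z; rewrite slot1_sdim.
  (* The superdimension is [2 (m1 - n) + 1], so the quantity in question is twice this integer plus
     1. *)
  have := odd_intr_neq0 (m1%:Z - n%:Z + k - #|lowset m1 r|%:Z + z).
  apply: contraNN => /eqP e; apply/eqP; rewrite -[RHS]e !natrD.
  by rewrite !(intrD, intrM, mulrNz); ring.
by move=> v; rewrite slot1_laplace.
Qed.

Lemma component_irreducible (T : {set 'I_(n + n)}) (k : int) :
  osp_irreducible2 T (component T k : superpoly F (n + n) m -> Prop).
Proof.
apply: (irreducible_ext (slot2_act T)).
apply: (slot_irreducible F0 slot2_bij slot2_par (k := k)).
  move=> z; rewrite slot2_sdim.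
  (* Now the superdimension is [2 n - (2 m1 + 1) = 2 (n - m1 - 1) + 1]. *)
  have := odd_intr_neq0 (n%:Z - m1%:Z - 1 + k - #|T|%:Z + z).
  apply: contraNN => /eqP e; apply/eqP; rewrite -[RHS]e !natrD.
  by rewrite !(intrD, intrM, mulrNz); ring.
(* Here [eps = -1], so [laplace] is zero and every vector of the component is harmonic. *)
move=> v; split=> [cv|[]//]; split=> //.
have n2 : 2%:R != 0 :> F by have /pcharf0P-> := F0.
exact: (laplace_eps (slot_oscillator F T slot2_bij slot2_par) v (erefl _) n2).
Qed.

End Families.

Theorem theorem3 (R : realType) (m1 n : nat) (hm1 : (1 <= m1)%N)
    (hn : (1 <= n)%N) :
  (forall (r : nat) (k : int), (r <= m1)%N -> (r = 0%N -> 0 <= k) ->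
     @osp_irreducible1 R[i] m1 n r (@superharmonic R[i] m1 n r k)) /\
  (forall (T : {set 'I_(n + n)}) (k : nat),
     @osp_irreducible2 R[i] m1 n T
       (@component R[i] (n + n) (m1 + m1 + 1) T k%:Z)).
Proof.
have F0 : [pchar R[i]] =i pred0 by apply: pchar_num.
split=> [r k le_r _|T k]; first exact: (superharmonic_irreducible n F0).
exact: (component_irreducible m1 F0).
Qed.
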